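(* The sequence of random recursive trees $(T_n)_{n=1}^\infty$ has, as a sequence of unordered trees, the same distribution as the sequence of random split trees $(T_n^{\mathcal P})_{n=1}^\infty$ with $b=\infty$ and split vector $\mathcal P\sim\mathrm{GEM}(0,1)$; the same holds with $\mathcal P\sim\mathrm{PD}(0,1)$.
   Context: **Random recursive tree.** $T_1$ is a single root; $T_{n+1}$ is obtained from $T_n$ by adding one new node as a child of an existing node chosen uniformly at random. (Equivalently this is the linear preferential attachment tree $T_n^{\chi,\rho}$ with $\chi=0$, $\rho=1$, where the parent $v$ is chosen with probability proportional to $\chi d(v)+\rho$, with $d(v)$ the current outdegree of $v$.) **Random split tree** with $b=\infty$. Let $\mathcal T_\infty$ be the infinite rooted tree where every node has children labelled $1,2,3,\dots$. Let $\mathcal P=(P_i)_{i=1}^\infty$ be a random vector with $P_i\ge0$ and $\sum_i P_i=1$ (the split vector). Give each node $v$ of $\mathcal T_\infty$ an independent copy $\mathcal P^{(v)}=(P^{(v)}_i)_i$ of $\mathcal P$, chosen once and kept fixed. Each node holds at most one ball and is full if it holds one; initially all nodes are empty. Balls arrive one by one at the root and move instantaneously: (i) a ball arriving at an empty node stays there, making it full; (ii) a ball arriving at a full node $v$ continues to a child of $v$, child $i$ being chosen with probability $P_i^{(v)}$; given all vectors $\mathcal P^{(v)}$, all these choices are independent. $T_n^{\mathcal P}$ is the subtree of $\mathcal T_\infty$ consisting of the nodes that contain the first $n$ balls; all $T_n^{\mathcal P}$, $n\ge1$, are constructed from the same stream of balls. **Unordered trees.** Both sequences are increasing sequences of trees.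 Regarding them as sequences of unordered trees means ignoring the original labels of the children; equivalently, the children of each node are (re)labelled $1,2,3,\dots$ in order of appearance in both sequences. **Distributions.** $B(\alpha,\beta)$ for $\alpha,\beta>0$ is the Beta distribution on $[0,1]$ with density proportional to $x^{\alpha-1}(1-x)^{\beta-1}$. $\mathrm{GEM}(\alpha,\theta)$ is the distribution of the random probability vector $(P_i)_{i=1}^\infty$ given by $P_i=Z_i\prod_{j=1}^{i-1}(1-Z_j)$, where the $Z_j$ are independent with $Z_j\sim B(1-\alpha,\theta+j\alpha)$; here $(\alpha,\theta)=(0,1)$. $\mathrm{PD}(\alpha,\theta)$ is the distribution of the vector obtained by reordering $(P_i)_{i=1}^\infty\sim\mathrm{GEM}(\alpha,\theta)$ in decreasing order. *)

(* Defs.v *)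
From HB Require Import structures.
From mathcomp Require Import all_boot all_order all_algebra finmap.
From mathcomp Require Import all_classical all_reals all_analysis.
Set Implicit Arguments.
Unset Strict Implicit.
Unset Printing Implicit Defensive.
Import Order.TTheory GRing.Theory Num.Theory.
Import numFieldNormedType.Exports.
Local Open Scope classical_set_scope.
Local Open Scope ring_scope.

(* A node of T_oo is the word of child labels on its path from the root [::];
   labels are 0-based, so that [rcons v i] is child number i+1 of v. *)
Definition node := seq nat.
Definition tree := {fset node}.

Definition is_child (v u : node) : bool := u == rcons v (last 0%N u).

Definition children (t : tree) (v : node) : tree :=
  [fset u in t | is_child v u]%fset.

Definition outdegree (t : tree) (v : node) : nat := #|` children t v|.

(* [appearance_rank t n v i] is the number of children of v in t n that
   appeared in the increasing sequence t strictly before the child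
   [rcons v i]; it is the new (0-based) label of that child. *)
Definition appearance_rank (t : nat -> tree) (n : nat) (v : node) (i : nat) : nat :=
  #|` [fset u in children (t n) v |
        [exists k : 'I_n, (u \in t k) && (rcons v i \notin t k)]]%fset |.

Definition relabel_node (t : nat -> tree) (n : nat) (v : node) : node :=
  mkseq (fun j => appearance_rank t n (take j v) (nth 0%N v j)) (size v).

(* An increasing sequence of unordered trees, represented by relabelling the
   children of each node in order of appearance. *)
Definition unordered (t : nat -> tree) (n : nat) : tree :=
  [fset relabel_node t n v | v in t n]%fset.

(* The product sigma-algebra on functions I -> T, where G is the
   sigma-algebra on T. *)
Definition product_sigma (I T : Type) (G : set (set T)) : set (set (I -> T)) :=
  <<s [set A | exists i : I, exists2 B, G B & A = [set x | B (x i)]] >>.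

Definition real_sequence_events (R : realType) : set (set (nat -> R)) :=
  product_sigma (fun B : set R => measurable B).

(* A tree takes countably many values: every set of trees is an event. *)
Definition tree_sequence_events : set (set (nat -> tree)) :=
  product_sigma [set: set tree].

Definition same_law (R : realType) (S : Type) (G : set (set S))
    (d1 : measure_display) (O1 : measurableType d1) (P1 : probability O1 R)
    (X1 : O1 -> S)
    (d2 : measure_display) (O2 : measurableType d2) (P2 : probability O2 R)
    (X2 : O2 -> S) : Prop :=
  forall A, G A -> P1 (X1 @^-1` A) = P2 (X2 @^-1` A).

Definition mutually_independent (R : realType) (d : measure_display)
    (O : measurableType d) (P : probability O R)
    (I : eqType) (S : Type) (G : set (set S)) (X : I -> O -> S) : Prop :=
  forall (s : seq I) (A : I -> set S), uniq s -> (forall i, G (A i)) ->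
    P (\big[setI/setT]_(i <- s) (X i @^-1` A i)) =
    (\prod_(i <- s) P (X i @^-1` A i))%E.

Definition random_sequence (R : realType) (d : measure_display)
    (O : measurableType d) (X : O -> nat -> R) : Prop :=
  forall i, measurable_fun [set: O] (fun w => X w i).

(* The library's [beta_prob] only covers integer parameters. *)
Definition beta_weight (R : realType) (a b x : R) : R :=
  x `^ (a - 1) * (1 - x) `^ (b - 1).

Definition beta_mass (R : realType) (a b : R) (A : set R) : \bar R :=
  (\int[lebesgue_measure]_(x in A `&` `[0%R, 1%R]) (beta_weight a b x)%:E)%E.

Definition beta_law (R : realType) (a b : R) (A : set R) : \bar R :=
  (beta_mass a b A * ((fine (beta_mass a b setT))^-1)%:E)%E.

Definition stick_breaking (R : realType) (z : nat -> R) (i : nat) : R :=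
  z i * \prod_(j < i) (1 - z j).

(* [GEM_distributed alpha theta P X]: under P, X ~ GEM(alpha, theta).
   With 0-based indices, Z_j ~ B(1 - alpha, theta + (j + 1) alpha). *)
Definition GEM_distributed (R : realType) (alpha theta : R)
    (d : measure_display) (O : measurableType d) (P : probability O R)
    (X : O -> nat -> R) : Prop :=
  random_sequence X /\
  exists (d' : measure_display) (O' : measurableType d')
      (P' : probability O' R) (Z : nat -> {RV P' >-> R}),
    [/\ mutually_independent P' (fun B : set R => measurable B)
          (fun j => Z j : O' -> R),
        forall j (B : set R), measurable B ->
          distribution P' (Z j) B =
          beta_law (1 - alpha) (theta + j.+1%:R * alpha) B
      & same_law (@real_sequence_events R) P X
          P' (fun w => stick_breaking (fun j => Z j w))].

(* q lists the entries of p in decreasing order.  Reordering by a bijection is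
   adequate here because the entries of a GEM vector are almost surely all
   positive. *)
Definition decreasing_reordering (R : realType) (p q : nat -> R) : Prop :=
  nonincreasing_seq q /\
  exists2 s : nat -> nat, bijective s & forall i, q i = p (s i).

Definition PD_distributed (R : realType) (alpha theta : R)
    (d : measure_display) (O : measurableType d) (P : probability O R)
    (X : O -> nat -> R) : Prop :=
  random_sequence X /\
  exists (d' : measure_display) (O' : measurableType d')
      (P' : probability O' R) (Y Y' : O' -> nat -> R),
    [/\ GEM_distributed alpha theta P' Y,
        random_sequence Y',
        {ae P', forall w, decreasing_reordering (Y w) (Y' w)}
      & same_law (@real_sequence_events R) P X P' Y'].

(* [T n] is the tree with n nodes, for n >= 1 ([T 0] is irrelevant); [V n] is
   the node of [T n] that receives a new child: its conditional law given
   T_1, ..., T_n is uniform on [T n]. *)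
Definition random_recursive_trees (R : realType) (d : measure_display)
    (O : measurableType d) (P : probability O R) (T : nat -> O -> tree) : Prop :=
  exists V : nat -> O -> node,
    [/\ forall n v, measurable [set w | V n w = v],
        forall w, T 1%N w = [fset [::]]%fset,
        forall n w, (0 < n)%N ->
          T n.+1 w =
          (T n w `|` [fset rcons (V n w) (outdegree (T n w) (V n w))])%fset
      & forall (n : nat) (t : nat -> tree) (v : node),
          (0 < n)%N -> v \in t n ->
          let past := [set w | forall k, (0 < k <= n)%N -> T k w = t k] in
          P (past `&` [set w | V n w = v]) =
          (P past * ((#|` t n|%:R : R)^-1)%:E)%E].

(* The final position of a ball that starts at the root when t is the set of
   full nodes and that moves from a full node v to its child [rcons v (c v)].
   The ball meets each full node at most once, so #|t| steps suffice. *)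
Definition landing_node (t : tree) (c : node -> nat) : node :=
  iter #|` t| (fun v => if v \in t then rcons v (c v) else v) [::].

(* [c k v] is the child chosen by ball number k+1 if it arrives at v when v is
   full. *)
Fixpoint split_tree (c : nat -> node -> nat) (n : nat) : tree :=
  if n is m.+1 then
    let t := split_tree c m in (t `|` [fset landing_node t (c m)])%fset
  else fset0.

Definition split_vector (R : realType) (d : measure_display)
    (O : measurableType d) (P : probability O R) (X : O -> nat -> R) : Prop :=
  random_sequence X /\
  {ae P, forall w, (forall i, 0 <= X w i) /\ series (X w) @ \oo --> (1 : R)}.

(* The sigma-algebra generated by all the vectors [Q v]. *)
Definition vector_events (R : realType) (O : Type)
    (Q : node -> O -> nat -> R) : set (set O) :=
  <<s [set E | exists v : node, exists2 B, real_sequence_events B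
                 & E = Q v @^-1` B] >>.

(* The sequence S (S n being the tree holding the first n balls) is a sequence
   of random split trees with b = oo and split vector X.  [Q v] is the copy of
   X at v; the last clause says that, conditionally on all the vectors, the
   choices [C k v] are independent and [C k v] = i with probability [Q v _ i]. *)
Definition random_split_trees (R : realType)
    (d0 : measure_display) (O0 : measurableType d0) (P0 : probability O0 R)
    (X : O0 -> nat -> R)
    (d : measure_display) (O : measurableType d) (P : probability O R)
    (S : nat -> O -> tree) : Prop :=
  split_vector P0 X /\
  exists (Q : node -> O -> nat -> R) (C : nat -> node -> O -> nat),
    [/\ (forall v, random_sequence (Q v)) /\
          (forall v, same_law (@real_sequence_events R) P (Q v) P0 X) /\
          mutually_independent P (@real_sequence_events R) Q,
        forall k v, measurable_fun [set: O] (C k v),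
        forall n w, S n w = split_tree (fun k v => C k v w) n
      & forall (s : seq (nat * node)) (i : nat * node -> nat) (A : set O),
          uniq s -> vector_events Q A ->
          P (A `&` \big[setI/setT]_(x <- s) [set w | C x.1 x.2 w = i x]) =
          (\int[P]_(w in A) (\prod_(x <- s) Q x.2 w (i x))%:E)%E].

(* Main.v *)
(* A recursive tree history is a parent function p with p k <= k (ball k+1 is a
   child of ball p k), so the first n+1 trees have n! possible histories and
   each has probability 1/n!.  On the split tree side, fix a history and choose
   the labels of the edges, distinct among siblings.  Given the split vectors,
   the balls follow the prescribed paths with a probability which is a product,
   over the nodes u, of monomials in the split vector at u, the exponent of the
   edge to a child being the number of balls in the subtree of that child.
   Summing over the labels and using independence gives the product over u of
   p(m_1, ..., m_d) = E[sum over distinct i_1, ..., i_d of prod_j P_(i_j)^(m_j)],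
   with m_1, ..., m_d the sizes of the subtrees of the children of u.  This sum
   is invariant under permutations of the split vector, so that GEM and PD give
   the same value.  For GEM(0,1), isolating the first stick yields
     p(m) = p(m) / (M+1) + sum_j B(m_j + 1, M - m_j + 1) p(m without m_j)
   with M = m_1 + ... + m_d, whence p(m) = prod_j (m_j - 1)! / M!, the Ewens
   formula.  As M + 1 is the size of the subtree of u, the product over u
   telescopes to 1/n!. *)
Require Import Defs.
From HB Require Import structures.
From mathcomp Require Import all_boot all_order all_algebra finmap.
From mathcomp Require Import all_classical all_reals all_analysis.
From mathcomp Require Import measurable_realfun.
From mathcomp Require Import ring lra.
Set Implicit Arguments.
Unset Strict Implicit.
Unset Printing Implicit Defensive.
Import Order.TTheory GRing.Theory Num.Theory.
Import numFieldNormedType.Exports.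
Local Open Scope classical_set_scope.
Local Open Scope ring_scope.

(** * Histories and addresses of the nodes *)

Section Histories.
Local Open Scope nat_scope.
Variable p : nat -> nat.

(* [chain j] is the path from the root to ball j, on which ball k+1 is denoted by
   k; [addr l j] is the node of ball j when ball k+1 has label l k among its
   siblings. *)
Fixpoint chain_rec (f j : nat) : seq nat :=
  if f is f'.+1 then if j is k.+1 then rcons (chain_rec f' (p k)) k else [::]
  else [::].

Definition chain (j : nat) : seq nat := chain_rec j j.

Definition addr (l : nat -> nat) (j : nat) : node := map l (chain j).

(** These are the labels by order of appearance, so [addr p sibling_rank] is the canonical form of a
    history. *)
Definition sibling_rank (k : nat) : nat := count (fun i => p i == p k) (iota 0 k).

Definition sibling_injective (n : nat) (l : nat -> nat) : Prop :=
  forall i k, i < n -> k < n -> p i = p k -> l i = l k -> i = k.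

Definition history_tree (l : nat -> nat) (n : nat) : tree :=
  [fset u in [seq addr l j | j <- iota 0 n.+1]]%fset.

Hypothesis p_le : forall k, p k <= k.

(** The parent [p k] of ball [k.+1] has a smaller index, so any fuel [f] at least [j] is enough to
    reach the root. *)
Lemma chain_recE f j : j <= f -> chain_rec f j = chain j.
Proof.
rewrite /chain; elim/ltn_ind: j f => -[|k] IH [|f] //= kf.
by rewrite !IH //= ?ltnS ?p_le // (leq_trans (p_le k)).
Qed.

Lemma chainS k : chain k.+1 = rcons (chain (p k)) k.
Proof. by rewrite {1}/chain /= chain_recE. Qed.

Lemma mem_chain_lt j k : k \in chain j -> k < j.
Proof.
elim/ltn_ind: j => -[|j] IH //; rewrite chainS mem_rcons inE => /orP[/eqP->//|].
by move/(IH _ (p_le j)) => kj; rewrite ltnS ltnW // (leq_trans kj).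
Qed.

Lemma uniq_chain j : uniq (chain j).
Proof.
elim/ltn_ind: j => -[|j] IH //; rewrite chainS rcons_uniq IH ?ltnS // andbT.
by apply/negP => /mem_chain_lt; rewrite ltnNge p_le.
Qed.

Lemma size_chain_le j : size (chain j) <= j.
Proof.
elim/ltn_ind: j => -[|j] IH //; rewrite chainS size_rcons ltnS.
by rewrite (leq_trans (IH _ _)) ?ltnS.
Qed.

Lemma addrS l k : addr l k.+1 = rcons (addr l (p k)) (l k).
Proof. by rewrite /addr chainS map_rcons. Qed.

Lemma addrSneq0 l k : addr l k.+1 <> [::].
Proof. by rewrite addrS; case: (addr _ _). Qed.

(** Equal words have equal last letters and equal prefixes. By induction the parents coincide, so
    the balls are siblings with the same label. *)
Lemma addr_inj n l i j : sibling_injective n l -> i <= n -> j <= n ->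
  addr l i = addr l j -> i = j.
Proof.
move=> linj; elim/ltn_ind: i j => -[|i] IH [|j] // le_i le_j.
- by move/esym/addrSneq0.
- by move/addrSneq0.
rewrite !addrS => /rcons_inj[/IH eqp /linj->//].
by apply: eqp; rewrite ?ltnS // (leq_trans (p_le _)) // ltnW.
Qed.

Lemma mem_history_tree l n u :
  reflect (exists2 j, j <= n & u = addr l j) (u \in history_tree l n).
Proof.
rewrite in_fset; apply: (iffP mapP) => -[j].
  by rewrite mem_iota add0n ltnS /= => jn ->; exists j.
by move=> jn ->; exists j; rewrite // mem_iota add0n ltnS.
Qed.

Lemma history_treeS l n :
  history_tree l n.+1 = (history_tree l n `|` [fset addr l n.+1])%fset.
Proof.
apply/fsetP => u; rewrite in_fsetU in_fset1.
apply/mem_history_tree/orP => [[j]|[|/eqP->]]; last by exists n.+1.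
  rewrite leq_eqVlt => /orP[/eqP->->|jn ->]; [by right | left].
  by apply/mem_history_tree; exists j.
by move=> /mem_history_tree[j jn ->]; exists j; rewrite // (leq_trans jn).
Qed.

Lemma history_tree0 l : history_tree l 0 = [fset [::]]%fset.
Proof. by apply/fsetP => u; rewrite in_fset in_fset1 mem_seq1. Qed.

Lemma addr_in l n i : sibling_injective n l -> i <= n -> forall k, k <= n ->
  (addr l i \in history_tree l k) = (i <= k).
Proof.
move=> linj le_in k le_kn; apply/mem_history_tree/idP => [[j jk]|ik].
  by move/(addr_inj linj) => -> //; rewrite (leq_trans jk).
by exists i.
Qed.

Lemma card_history_tree l n : sibling_injective n l ->
  #|` history_tree l n| = n.+1.
Proof.
move=> linj; rewrite /history_tree card_fseq undup_id ?size_map ?size_iota //.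
rewrite map_inj_in_uniq ?iota_uniq // => i j.
by rewrite !mem_iota !add0n !ltnS => /= le_i le_j; apply: (addr_inj linj).
Qed.

Lemma is_child_addr l u k : is_child u (addr l k.+1) = (u == addr l (p k)).
Proof.
rewrite /is_child addrS last_rcons; apply/eqP/eqP => [/rcons_inj[]//|->//].
Qed.

Lemma mem_children l n j u : sibling_injective n l -> j <= n ->
  reflect (exists2 k, k < n & p k = j /\ u = addr l k.+1)
          (u \in children (history_tree l n) (addr l j)).
Proof.
move=> linj jn; rewrite /children in_fset.
apply: (iffP andP) => [[]|[k kn [<- ->]]].
  move=> /mem_history_tree[[|k] kn ->].
    by rewrite /is_child /addr /=; case: (chain j).
  rewrite is_child_addr => /eqP /(addr_inj linj) eqj; exists k => //; split=> //.
  by rewrite -eqj // (leq_trans (p_le k)) // ltnW.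
split; last by rewrite is_child_addr.
by apply/mem_history_tree; exists k.+1.
Qed.

Lemma card_siblings l n k j : sibling_injective n l -> k <= n ->
  #|` [fset u in [seq addr l i.+1 | i <- iota 0 k & p i == j]]%fset| =
  count (fun i => p i == j) (iota 0 k).
Proof.
move=> linj kn; rewrite card_fseq undup_id ?size_map ?size_filter //.
rewrite map_inj_in_uniq ?filter_uniq ?iota_uniq // => i i'.
rewrite !mem_filter !mem_iota !add0n /= => /andP[_ ik] /andP[_ i'k].
by move=> /(addr_inj linj) -/(_ (leq_trans ik kn) (leq_trans i'k kn)) [].
Qed.

Lemma outdegree_history l n j : sibling_injective n l -> j <= n ->
  outdegree (history_tree l n) (addr l j) =
  count (fun i => p i == j) (iota 0 n).
Proof.
move=> linj jn; rewrite /outdegree -(card_siblings j linj (leqnn n)).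
congr (#|` _ |); apply/fsetP => u; rewrite [RHS]in_fset.
apply/mem_children/mapP => // -[k].
  by move=> kn [pk ->]; exists k; rewrite // mem_filter pk eqxx mem_iota.
by rewrite mem_filter mem_iota add0n /= => /andP[/eqP pk kn] ->; exists k.
Qed.

Lemma sibling_rank_injective n : sibling_injective n sibling_rank.
Proof.
suff lt i k : i < k -> p i = p k -> sibling_rank i < sibling_rank k.
  move=> i k _ _ pik eqr; case: (ltngtP i k) => // /lt.
    by move/(_ pik); rewrite eqr ltnn.
  by move/(_ (esym pik)); rewrite eqr ltnn.
move=> ik pik; rewrite /sibling_rank -pik.
have -> : iota 0 k = iota 0 i ++ i :: iota i.+1 (k - i.+1).
  by rewrite -[i :: _]/(iota i _.+1) subnSK // -iotaD subnKC // ltnW.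
by rewrite count_cat /= eqxx addnS ltnS leq_addr.
Qed.

Lemma appearance_rank_addr (t : nat -> tree) n l k :
    sibling_injective n l -> (forall j, j <= n -> t j = history_tree l j) ->
    k < n -> appearance_rank t n (addr l (p k)) (l k) = sibling_rank k.
Proof.
move=> linj tE kn; rewrite /appearance_rank /sibling_rank.
rewrite -(card_siblings (p k) linj (ltnW kn)) tE // -addrS.
have pkn : p k <= n by rewrite (leq_trans (p_le k)) // ltnW.
congr (#|` _ |); apply/fsetP => u; rewrite [RHS]in_fset in_fset inE /=.
apply/andP/mapP => [[/mem_children-/(_ linj pkn)[i i_n [pi ->]]]|].
  (* Time [k'] separates the two siblings: the tree then holds balls 0 to [k'], so ball [i.+1] is
     present and ball [k.+1] is not. *)
  case/existsP => k' /andP[]; rewrite !tE ?(ltnW (ltn_ord _)) //.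
  rewrite !(addr_in linj) ?(ltnW (ltn_ord _)) // -ltnNge ltnS => ik' k'k.
  by exists i; rewrite // mem_filter pi eqxx mem_iota (leq_trans ik').
move=> [i]; rewrite mem_filter mem_iota add0n /= => /andP[/eqP pi ik] ->.
split; first by apply/mem_children => //; exists i; rewrite // (ltn_trans ik).
(* At time [k], just before ball [k.+1] arrives, every earlier sibling is already present. *)
apply/existsP; exists (Ordinal kn) => /=; rewrite !tE ?(ltnW kn) //.
by rewrite !(addr_in linj) ?(ltnW kn) ?ltnn ?ik // (ltn_trans ik kn).
Qed.

Lemma relabel_addr (t : nat -> tree) n l j :
    sibling_injective n l -> (forall j, j <= n -> t j = history_tree l j) ->
    j <= n -> relabel_node t n (addr l j) = addr sibling_rank j.
Proof.
move=> linj tE; elim/ltn_ind: j => -[|k] IH kn //.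
rewrite [RHS]addrS -IH ?ltnS ?p_le //; last by rewrite (leq_trans (p_le k)) // ltnW.
rewrite /relabel_node addrS size_rcons.
set v := addr l (p k).
rewrite mkseqS; congr rcons; last first.
  rewrite nth_rcons ltnn eqxx -[rcons v _]cats1 take_size_cat //.
  exact: appearance_rank_addr.
apply/eq_in_map => i; rewrite mem_iota add0n => /= iv.
by rewrite nth_rcons iv -cats1 takel_cat // ltnW.
Qed.

(** Forgetting the labels leaves only the parent function: whatever [l] is, relabelling turns the
    address of each ball into its address by sibling ranks. *)
Lemma unordered_history (t : nat -> tree) n l :
    sibling_injective n l -> (forall j, j <= n -> t j = history_tree l j) ->
    forall j, j <= n -> unordered t j = history_tree sibling_rank j.
Proof.
move=> linj tE j jn; have linj' : sibling_injective j l.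
  by move=> i k ij kj; apply: linj; exact: leq_trans jn.
have tE' i : i <= j -> t i = history_tree l i by move=> ij; apply: tE; exact: leq_trans jn.
rewrite /unordered tE //; apply/fsetP => u.
apply/imfsetP/mem_history_tree => /=.
  by move=> [v /mem_history_tree[i ij ->] ->]; exists i; rewrite // (relabel_addr linj' tE').
move=> [i ij ->]; exists (addr l i); last by rewrite (relabel_addr linj' tE').
by apply/mem_history_tree; exists i.
Qed.

Lemma take_addr l j i : i < size (addr l j) ->
  exists2 k, k \in chain j & take i (addr l j) = addr l (p k) /\
    nth 0 (addr l j) i = l k.
Proof.
elim/ltn_ind: j => -[|j] IH //; rewrite addrS size_rcons ltnS leq_eqVlt.
case/orP => [/eqP->|ij].
  exists j; first by rewrite chainS mem_rcons mem_head.
  by rewrite nth_rcons ltnn eqxx -cats1 take_size_cat.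
have [k kj [tk nk]] := IH (p j) (p_le j) ij.
exists k; first by rewrite chainS mem_rcons inE kj orbT.
by rewrite nth_rcons ij -cats1 takel_cat // ltnW.
Qed.

(** Only finitely many values of [c] are constrained, namely those at the proper prefixes of the
    first [n.+1] addresses, so the event has a finite product as its conditional probability. *)
Definition follows (l : nat -> nat) (n : nat) (c : nat -> node -> nat) : Prop :=
  forall j, j <= n -> forall i, i < size (addr l j) ->
    c j (take i (addr l j)) = nth 0 (addr l j) i.

(** All proper prefixes of the address of ball [j.+1] are full, so the ball walks along its address;
    the address itself is empty, so it stops there. *)
Lemma landing_addr l n c : sibling_injective n l -> follows l n c ->
  forall j, j < n -> landing_node (history_tree l j) (c j.+1) = addr l j.+1.
Proof.
move=> linj fc j jn; rewrite /landing_node card_history_tree; last first.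
  by move=> i k ij kj; apply: linj; exact: ltn_trans jn.
set t := history_tree l j; set a := addr l j.+1.
have walk i : i <= size a ->
    iter i (fun v => if v \in t then rcons v (c j.+1 v) else v) [::] = take i a.
  elim: i => [|i IH] ia; first by rewrite take0.
  rewrite iterS (IH (ltnW ia)); have [k kj [tk _]] := take_addr ia.
  have -> : take i a \in t.
    rewrite tk; apply/mem_history_tree; exists (p k) => //.
    by rewrite (leq_trans (p_le k)) // -ltnS mem_chain_lt.
  by rewrite (fc _ jn _ ia) -take_nth.
have le_a : size a <= j.+1 by rewrite size_map size_chain_le.
(* The address may be shorter than the number of iterations; the remaining ones do not move the
   ball. *)
rewrite -[X in iter X](subnK le_a) iterD walk // take_size.
have a_t : (a \in t) = false by rewrite (addr_in linj) ?ltnn // ltnW.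
by elim: (_ - _) => //= i ->; rewrite a_t.
Qed.

Lemma split_tree_follows l n c : sibling_injective n l -> follows l n c ->
  forall j, j <= n -> split_tree c j.+1 = history_tree l j.
Proof.
move=> linj fc; elim=> [|j IH] jn.
  by rewrite /= fset0U /landing_node cardfs0 history_tree0.
by rewrite [LHS]/= -/(split_tree c j.+1) (IH (ltnW jn)) (landing_addr linj fc jn) history_treeS.
Qed.

End Histories.

(** Each tree has exactly one node more than the one before, so the sequence of trees reveals where
    every ball sits. *)
Lemma history_tree_addr (p p' l l' : nat -> nat) n :
    (forall k, (p k <= k)%N) -> (forall k, (p' k <= k)%N) ->
    sibling_injective p n l -> sibling_injective p' n l' ->
    (forall j, (j <= n)%N -> history_tree p l j = history_tree p' l' j) ->
  forall j, (j <= n)%N -> addr p l j = addr p' l' j.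
Proof.
move=> p_le p'_le linj linj' tE [|j] jn //.
have : addr p l j.+1 \in history_tree p' l' j.+1.
  by rewrite -tE //; apply/mem_history_tree; exists j.+1.
rewrite history_treeS // in_fsetU in_fset1 => /orP[|/eqP//].
by rewrite -tE ?(ltnW jn) // (addr_in p_le linj) ?ltnn // ltnW.
Qed.

Lemma addr_determines (p p' l l' : nat -> nat) n :
    (forall k, (p k <= k)%N) -> (forall k, (p' k <= k)%N) ->
    sibling_injective p n l ->
    (forall j, (j <= n)%N -> addr p l j = addr p' l' j) ->
  forall k, (k < n)%N -> p k = p' k /\ l k = l' k.
Proof.
move=> p_le p'_le linj aE k kn.
have := aE k.+1 kn; rewrite !addrS // => /rcons_inj[+ ->].
rewrite -aE ?(leq_trans (p'_le k)) ?(ltnW kn) // => /(addr_inj p_le linj) -> //;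
by rewrite (leq_trans _ (ltnW kn)).
Qed.

(** * Countably valued random variables *)

Section CountablyValued.
Context (d : measure_display) (O : measurableType d).

(** This is measurability for maps into countable types, such as trees and nodes, without equipping
    them with a sigma-algebra. *)
Definition measurable_fibers (C : Type) (f : O -> C) : Prop :=
  forall c, measurable [set w | f w = c].

Lemma measurable_fibers_preimage (C : countType) (f : O -> C) (A : set C) :
  measurable_fibers f -> measurable (f @^-1` A).
Proof.
move=> mf.
have -> : f @^-1` A = \bigcup_(c in [set: C]) ([set w | f w = c] `&` [set _ | A c]).
  apply/seteqP; split => [w Aw|w [c _ /= [-> //]]].
  by exists (f w).
apply: countable_bigcupT_measurable => [|c]; first exact: countableP.
have [Ac|nAc] := pselect (A c).
  by rewrite (_ : [set _ | A c] = setT) ?setIT //; apply/seteqP; split.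
by rewrite (_ : [set _ | A c] = set0) ?setI0 //; apply/seteqP; split.
Qed.

(** The event is split over the countably many values [c] of [f], on each of which the random
    function [g] is the fixed variable [g c]. *)
Lemma measurable_fibers_bind (C : countType) (D : Type) (f : O -> C)
    (g : C -> O -> D) : measurable_fibers f ->
  (forall c, measurable_fibers (g c)) -> measurable_fibers (fun w => g (f w) w).
Proof.
move=> mf mg e.
rewrite (_ : [set w | _] =
    \bigcup_(c in [set: C]) ([set w | f w = c] `&` [set w | g c w = e])); last first.
  by apply/seteqP; split => [w gw|w [c _ /= [<- //]]]; exists (f w).
apply: countable_bigcupT_measurable => [|c]; first exact: countableP.
by apply: measurableI; [exact: mf | exact: mg].
Qed.

Lemma measurable_fibers_cst (C : Type) (c : C) : measurable_fibers (fun=> c).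
Proof.
move=> e; have [->|ce] := pselect (c = e).
  by rewrite (_ : [set _ | _] = setT) //; apply/seteqP; split.
by rewrite (_ : [set _ | _] = set0) //; apply/seteqP; split.
Qed.

Lemma measurable_fibers_comp (C : countType) (D : Type) (f : O -> C)
    (g : C -> D) : measurable_fibers f -> measurable_fibers (fun w => g (f w)).
Proof.
move=> mf; apply: (measurable_fibers_bind (g := fun c _ => g c)) => // c.
exact: measurable_fibers_cst.
Qed.

Lemma measurable_fibers_comp2 (C D : countType) (E : Type) (f : O -> C)
    (f' : O -> D) (g : C -> D -> E) : measurable_fibers f ->
  measurable_fibers f' -> measurable_fibers (fun w => g (f w) (f' w)).
Proof.
move=> mf mf'; apply: (measurable_fibers_bind (g := fun c w => g c (f' w))) => // c.
exact: measurable_fibers_comp.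
Qed.

Lemma measurable_fibers_mkseq (C : countType) (X : nat -> O -> C) n :
  (forall i, measurable_fibers (X i)) ->
  measurable_fibers (fun w => mkseq (X ^~ w) n).
Proof.
move=> mX; elim: n => [|n IH]; first exact: measurable_fibers_cst.
rewrite (_ : (fun w => _) = (fun w => rcons (mkseq (X ^~ w) n) (X n w))).
  exact: measurable_fibers_comp2.
by apply/funext => w; rewrite mkseqS.
Qed.

End CountablyValued.

Lemma measure_finType_bigcup (R : realType) (d : measure_display)
    (O : measurableType d) (P : probability O R) (I : finType) (p : pred I)
    (F : I -> set O) : (forall i, p i -> measurable (F i)) -> trivIset [set` p] F ->
  P (\bigcup_(i in [set` p]) F i) = (\sum_(i | p i) P (F i))%E.
Proof.
move=> mF tF; rewrite measure_fin_bigcup // (bigfs _ (r := index_enum I)) //.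
  exact: index_enum_uniq.
by move=> i _; rewrite mem_index_enum.
Qed.

(** * Events determined by finitely many terms of a sequence *)

Section FinitelyDetermined.
Variable C : countType.

Definition determined_upto (n : nat) (A : set (nat -> C)) : Prop :=
  forall x y, (forall i, (i <= n)%N -> x i = y i) -> A x -> A y.

Lemma determined_uptoC n A : determined_upto n A -> determined_upto n (~` A).
Proof.
by move=> dA x y xy nAx Ay; apply: nAx; apply: dA Ay => i /xy.
Qed.

Section Bounds.
Context (R : realType) (d : measure_display) (O : measurableType d).
Context (P : probability O R) (U : O -> nat -> C).
Hypothesis mU : forall i, measurable_fibers (U ^~ i).

Lemma measurable_determined n A : determined_upto n A -> measurable (U @^-1` A).
Proof.
move=> dA.
rewrite (_ : U @^-1` A = (fun w => mkseq (U w) n.+1) @^-1`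
    [set s | exists2 x, A x & mkseq x n.+1 = s]).
  by apply: measurable_fibers_preimage; exact: (measurable_fibers_mkseq (X := fun i w => U w i)).
apply/seteqP; split => [w Aw|w [x Ax /= xU]]; first by exists (U w).
apply: dA Ax => i; rewrite -ltnS => ilt.
by rewrite -(nth_mkseq (x 0%N) x ilt) xU nth_mkseq.
Qed.

Variables (n : nat) (H : finType) (B : H -> nat -> C).
Hypothesis B_inj : forall q q', (forall i, (i <= n)%N -> B q i = B q' i) -> q = q'.
Hypothesis B_prob : forall q,
  ((#|H|%:R^-1)%:E <= P [set w | forall i, (i <= n)%N -> U w i = B q i])%E.

Lemma determined_prob_ge A : determined_upto n A ->
  (((\sum_(q | `[< A (B q) >]) #|H|%:R^-1 : R))%:E <= P (U @^-1` A))%E.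
Proof.
move=> dA.
pose E q := [set w | forall i, (i <= n)%N -> U w i = B q i].
have mE q : measurable (E q).
  rewrite (_ : E q = U @^-1` [set x | forall i, (i <= n)%N -> x i = B q i]) //.
  by apply: (@measurable_determined n) => x y xy xB i ilt; rewrite -xy // xB.
have tE : trivIset setT E.
  apply/trivIsetP => q q' _ _ /eqP qq'; apply/seteqP; split => // w [Eq Eq'].
  by apply: qq'; apply: B_inj => i ilt; rewrite -Eq // Eq'.
pose p q := `[< A (B q) >].
apply: (@le_trans _ _ (P (\bigcup_(q in [set` p]) E q))); last first.
  apply: le_measure; rewrite ?inE.
  - by apply: fin_bigcup_measurable => // q _; exact: mE.
  - exact: measurable_determined dA.
  - by move=> w [q /asboolP ABq Eq]; apply: dA ABq => i /Eq.
rewrite measure_finType_bigcup //; last exact: sub_trivIset tE.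
by rewrite -sumEFin; apply: lee_sum => q _; exact: B_prob.
Qed.

(** The lower bound is applied to [A] and to its complement. The two bounds add up to 1, as do the
    two probabilities, so both are equalities. *)
Lemma determined_prob A : (0 < #|H|)%N -> determined_upto n A ->
  P (U @^-1` A) = ((\sum_(q | `[< A (B q) >]) #|H|%:R^-1 : R))%:E.
Proof.
move=> H_gt0 dA; apply/eqP; rewrite eq_le determined_prob_ge // andbT.
have := determined_prob_ge (determined_uptoC dA).
rewrite preimage_setC probability_setC; last exact: measurable_determined dA.
have /fineK <- := fin_num_measure P (U @^-1` A) (measurable_determined dA).
rewrite -EFinB !lee_fin.
rewrite (eq_bigl (fun q => ~~ `[< A (B q) >])); last by move=> q; rewrite asbool_neg.
have : \sum_(q : H) #|H|%:R^-1 = 1 :> R.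
  by rewrite sumr_const -[LHS]mulr_natl divff // pnatr_eq0 -lt0n.
by rewrite (bigID (fun q => `[< A (B q) >])) /=; lra.
Qed.

End Bounds.
End FinitelyDetermined.

(** Finitely determined events form a pi-system that generates the product sigma-algebra, and the
    events of equal probability form a lambda-system. *)
Lemma product_sigma_same_law (C : countType) (R : realType)
    (d1 d2 : measure_display) (O1 : measurableType d1) (O2 : measurableType d2)
    (P1 : probability O1 R) (P2 : probability O2 R)
    (U1 : O1 -> nat -> C) (U2 : O2 -> nat -> C) :
  (forall i, measurable_fibers (U1 ^~ i)) ->
  (forall i, measurable_fibers (U2 ^~ i)) ->
  (forall n A, determined_upto n A -> P1 (U1 @^-1` A) = P2 (U2 @^-1` A)) ->
  same_law (product_sigma [set: set C]) P1 U1 P2 U2.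
Proof.
move=> mU1 mU2 U12 A GA.
pose G := [set A : set (nat -> C) | exists n, determined_upto n A].
pose D := [set A : set (nat -> C) | [/\ measurable (U1 @^-1` A),
  measurable (U2 @^-1` A) & P1 (U1 @^-1` A) = P2 (U2 @^-1` A)]].
suff : <<s G >> `<=` D.
  move=> /(_ A); case=> //; apply: sub_smallest2r GA.
    exact: smallest_sigma_algebra.
  move=> _ [i [B _ ->]]; exists i => x y xy; by rewrite /= xy.
apply: lambda_system_subset => //.
- move=> X Y [n dX] [m dY]; exists (maxn n m) => x y xy [Xx Yx]; split.
    by apply: dX Xx => i ni; apply: xy; rewrite leq_max ni.
  by apply: dY Yx => i ni; apply: xy; rewrite leq_max ni orbT.
- apply/dynkin_lambda_system; split.
  + by rewrite /D /= !preimage_setT !probability_setT.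
  + move=> X [m1 m2 e]; split.
    * by rewrite preimage_setC; exact: measurableC.
    * by rewrite preimage_setC; exact: measurableC.
    * have e1 := probability_setC P1 m1; have e2 := probability_setC P2 m2.
      by rewrite preimage_setC in e1; rewrite preimage_setC in e2; rewrite e1 e2 e.
  + move=> F tF DF; split; rewrite preimage_bigcup.
    * by apply: bigcupT_measurable => k; case: (DF k).
    * by apply: bigcupT_measurable => k; case: (DF k).
    * rewrite preimage_bigcup !measure_bigcup.
      - by apply: eq_eseriesr => k _; case: (DF k).
      - by move=> k _; case: (DF k).
      - by move=> i j _ _ [w Fw]; apply: tF => //; eexists; exact: Fw.
      - by move=> k _; case: (DF k).
      - by move=> i j _ _ [w Fw]; apply: tF => //; eexists; exact: Fw.
- move=> X [n dX]; split; [exact: measurable_determined dX..|exact: U12 dX].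
Qed.

(** * Random recursive trees *)

Section RandomRecursiveTrees.
Context (R : realType) (d : measure_display) (O : measurableType d).
Context (P : probability O R) (T : nat -> O -> tree).
Hypothesis hT : random_recursive_trees P T.

Lemma measurable_fibers_random_recursive_trees n : measurable_fibers (T n.+1).
Proof.
have [V [mV T1 TS _]] := hT; elim: n => [|n IH].
  rewrite (_ : T 1%N = fun=> [fset [::]]%fset); last exact/funext.
  exact: measurable_fibers_cst.
pose add_child (t : tree) (v : node) : tree :=
  (t `|` [fset rcons v (outdegree t v)])%fset.
rewrite (_ : T n.+2 = fun w => add_child (T n.+1 w) (V n.+1 w)).
  exact: (measurable_fibers_comp2 add_child IH (mV n.+1)).
by apply/funext => w; rewrite TS.
Qed.

(** Induction on [n]: given the history so far, the new node is attached to ball [p n] with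
    probability 1/(n+1). *)
Lemma random_recursive_trees_prob_ge (p : nat -> nat) n :
  (forall k, (p k <= k)%N) ->
  ((n`!%:R^-1)%:E <= P [set w | forall i, (i <= n)%N ->
     T i.+1 w = history_tree p (sibling_rank p) i])%E.
Proof.
move=> p_le; have [V [mV T1 TS TV]] := hT.
set E := fun n => [set w | forall i, (i <= n)%N ->
  T i.+1 w = history_tree p (sibling_rank p) i].
have mE m : measurable (E m).
  rewrite (_ : E m = (fun w => mkseq (fun i => T i.+1 w) m.+1) @^-1`
      [set mkseq (history_tree p (sibling_rank p)) m.+1]).
    apply: measurable_fibers_preimage.
    apply: (measurable_fibers_mkseq (X := fun i w => T i.+1 w)) => i.
    exact: measurable_fibers_random_recursive_trees.
  apply/seteqP; split => [w Ew|w /= e i im].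
    by apply/eq_in_map => i; rewrite mem_iota add0n ltnS => /Ew.
  by rewrite -(nth_mkseq fset0 (fun i => T i.+1 w) (_ : (i < m.+1)%N)) ?e ?nth_mkseq ?ltnS.
have linj m := sibling_rank_injective (p := p) (n := m).
rewrite -/(E n); elim: n => [|n IH].
  rewrite (_ : E 0%N = setT) ?probability_setT ?fact0 ?invr1 //.
  by apply/seteqP; split => // w _ [|//] _; rewrite T1 history_tree0.
pose v := addr p (sibling_rank p) (p n).
(* The predecessor is there because [T k] has [k] nodes and [history_tree _ _ k] has [k.+1]. *)
pose t k := history_tree p (sibling_rank p) k.-1.
have vt : v \in t n.+1 by apply/mem_history_tree; exists (p n).
have := TV n.+1 t v isT vt.
rewrite (_ : [set w | _] = E n); last first.
  apply/seteqP; split => [w tw i im|w Ew [//|k]].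
    by rewrite (tw i.+1) // ltnS.
  by move=> /= kn; rewrite Ew.
rewrite /t card_history_tree //= => PV.
apply: (@le_trans _ _ (P (E n `&` [set w | V n.+1 w = v]))).
  rewrite PV factS natrM invfM mulrC EFinM.
  by apply: lee_wpmul2r => //; rewrite lee_fin.
apply: le_measure; rewrite ?inE //; first exact: measurableI.
move=> w [Ew Vw] i; rewrite leq_eqVlt => /orP[/eqP->|]; last exact: Ew.
(* The outdegree of the parent, used as label of the new child, is the sibling rank of that
   child. *)
rewrite TS // Vw Ew // /v outdegree_history // history_treeS // addrS //.
Qed.

End RandomRecursiveTrees.

(** * The finite type of histories *)

Section HistoryType.
Variable n : nat.

Definition history := {q : {ffun 'I_n -> 'I_n} |
  q \in family (fun k : 'I_n => [pred i : 'I_n | (i <= k)%N])}.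

(** The value 0 from [n] on keeps [parent q k <= k] true for all [k]. *)
Definition parent (q : history) (k : nat) : nat :=
  oapp (fun i : 'I_n => val (val q i)) 0%N (insub k).

Lemma parent_le q k : (parent q k <= k)%N.
Proof.
rewrite /parent; case: insubP => //= i _ <-.
by have /familyP/(_ i) := valP q.
Qed.

Lemma parent_inj q q' :
  (forall k, (k < n)%N -> parent q k = parent q' k) -> q = q'.
Proof.
move=> e; apply/val_inj/ffunP => i; apply/val_inj.
by have := e i (ltn_ord i); rewrite /parent valK.
Qed.

Lemma card_history : #|{: history}| = n`!.
Proof.
rewrite card_sig card_family.
rewrite fact_prod big_add1 big_mkord -[RHS]big_enum /= foldrE big_map.
apply: eq_bigr => k _; rewrite -sum1_card.
rewrite -[RHS]card_ord -[RHS]sum1_card (big_ord_widen n (fun=> 1%N) (ltn_ord k)).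
by apply: eq_bigl => i; rewrite ltnS.
Qed.

End HistoryType.

(** * Expectation of a product of independent variables *)

Section IndependentProducts.
Context (R : realType) (d : measure_display) (O : measurableType d).
Context (P : probability O R).

Import HBNNSimple.

(** Taking [B] to be the whole line shows that [c] is the integral of [g] over [D]; the hypothesis
    thus says that [Y] is independent of [g] restricted to [D]. The claim follows by splitting [phi]
    along its level sets. *)
Lemma integral_simple_mul (phi : {nnsfun R >-> R}) (Y g : O -> R) (D : set O) (c : R) :
  measurable D -> measurable_fun setT Y -> measurable_fun setT g ->
  (forall w, 0 <= g w) ->
  (forall B, measurable B ->
    (\int[P]_(w in D `&` Y @^-1` B) (g w)%:E = P (Y @^-1` B) * c%:E)%E) ->
  (\int[P]_(w in D) (phi (Y w) * g w)%:E =
   (\sum_(i < #|` fset_set (range phi)|)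
      ((fset_set (range phi))`_i)%:E *
      P (Y @^-1` (phi @^-1` [set (fset_set (range phi))`_i]))) * c%:E)%E.
Proof.
move=> mD mY mg g0 gY; set s := fset_set (range phi).
have s0 (i : 'I_#|` s|) : 0 <= s`_i.
  have : s`_i \in s by apply: mem_nth; exact: ltn_ord.
  by rewrite in_fset_set // inE => -[x _ <-].
have mE r : measurable (Y @^-1` (phi @^-1` [set r])).
  by rewrite -[X in measurable X]setTI; apply: mY.
have m1 r : measurable_fun D (fun w => \1_(Y @^-1` (phi @^-1` [set r])) w * g w).
  by apply: measurable_funTS; apply: measurable_funM.
transitivity (\int[P]_(w in D) (\sum_(i < #|` s|)
    ((s`_i)%:E * (\1_(Y @^-1` (phi @^-1` [set s`_i])) w * g w)%:E)))%E.
  apply: eq_integral => w _; rewrite (fimfunEord phi) -/s mulr_suml -sumEFin.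
  by apply: eq_bigr => i _; rewrite -EFinM mulrA.
rewrite ge0_integral_sum //; last 2 first.
- by move=> i; apply: measurable_funeM; exact/measurable_EFinP.
- move=> i w _; rewrite -EFinM lee_fin mulr_ge0 ?mulr_ge0 //.
have c0 : (0%R <= c%:E)%E.
  have := gY setT measurableT; rewrite preimage_setT probability_setT mul1e => <-.
  by apply: integral_ge0 => w _; rewrite lee_fin.
rewrite ge0_sume_distrl; last by move=> i _; rewrite mule_ge0 // lee_fin.
apply: eq_bigr => i _; rewrite ge0_integralZl //; last 3 first.
- exact/measurable_EFinP.
- by move=> w _; rewrite lee_fin mulr_ge0.
- by rewrite lee_fin.
rewrite -muleA; congr (_ * _)%E; rewrite -gY // integral_mkcondr.
apply: eq_integral => w _; rewrite patchE indicE.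
by case: ifP => _; rewrite ?mul1r ?mul0r.
Qed.

Lemma integral_indep_mul (Y g : O -> R) (D : set O) (c : R) :
  measurable D -> measurable_fun setT Y -> measurable_fun setT g ->
  (forall w, 0 <= Y w) -> (forall w, 0 <= g w) ->
  (forall B, measurable B ->
    (\int[P]_(w in D `&` Y @^-1` B) (g w)%:E = P (Y @^-1` B) * c%:E)%E) ->
  (\int[P]_(w in D) (Y w * g w)%:E = (\int[P]_w (Y w)%:E) * c%:E)%E.
Proof.
move=> mD mY mg Y0 g0 gY.
(* The approximation needs a function that is nonnegative on the whole line; the absolute value is
   one, and it is the identity on the values of [Y]. *)
have mnorm : measurable_fun [set: R] (fun x : R => `|x|%:E).
  by apply/measurable_EFinP; exact: normr_measurable.
pose phi := nnsfun_approx measurableT mnorm.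
have phi_cvg x : 0 <= x -> ((phi n x)%:E @[n --> \oo] --> x%:E)%classic.
  move=> x0; rewrite -[in X in _ --> X](ger0_norm x0).
  by apply: (cvg_nnsfun_approx measurableT mnorm) => // y _; rewrite lee_fin.
have phi_nd x : nondecreasing_seq (phi ^~ x).
  by move=> m n mn; exact/lefP/nd_nnsfun_approx.
have cvg_phi (h : O -> R) (E : set O) : measurable E -> measurable_fun setT h ->
    (forall w, 0 <= h w) ->
    (\int[P]_(w in E) (phi n (Y w) * h w)%:E @[n --> \oo] -->
     \int[P]_(w in E) (Y w * h w)%:E)%E.
  move=> mE mh h0.
  rewrite [X in _ --> X](_ : _ =
      \int[P]_(w in E) limn (fun n => (phi n (Y w) * h w)%:E))%E; last first.
    apply: eq_integral => w _; apply/esym/cvg_lim => //.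
    under eq_fun do rewrite EFinM.
    rewrite EFinM; apply: cvgeZr => //; exact: phi_cvg.
  apply: cvg_monotone_convergence => //.
  - move=> n; apply/measurable_EFinP; apply: measurable_funTS.
    by apply: measurable_funM => //; exact: measurableT_comp.
  - by move=> n w _; rewrite lee_fin mulr_ge0.
  - by move=> w _ m n mn; rewrite lee_fin ler_wpM2r // phi_nd.
(* The case where [g] is 1 identifies the limit of the sums over level sets as the mean of [Y]. *)
have one_cvg := cvg_phi (cst 1) setT measurableT (measurable_cst _) (fun=> ler01).
rewrite -(cvg_lim _ (cvg_phi g D mD mg g0)) //; apply/cvg_lim => //.
under eq_fun do rewrite (integral_simple_mul _ mD mY mg g0 gY).
apply: cvgeZr => //.
rewrite (_ : (\int[P]_w (Y w)%:E)%E = (\int[P]_w (Y w * cst 1 w)%:E)%E); last first.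
  by apply: eq_integral => w _; rewrite mulr1.
apply: cvg_trans one_cvg; apply: near_eq_cvg; apply: nearW => n /=.
rewrite (@integral_simple_mul _ _ (cst 1) setT 1) ?mule1 //.
move=> B mB; rewrite setTI mule1.
have mYB : measurable (Y @^-1` B) by rewrite -[X in measurable X]setTI; apply: mY.
by rewrite -[RHS]mul1e -(integral_cst P mYB).
Qed.

Lemma integral_prod_independent (I : eqType) (Y : I -> O -> R) (s : seq I) :
  (forall i, measurable_fun setT (Y i)) -> (forall i w, 0 <= Y i w) ->
  (forall i, (\int[P]_w (Y i w)%:E < +oo)%E) ->
  mutually_independent P (fun B : set R => measurable B) Y -> uniq s ->
  (\int[P]_w (\prod_(i <- s) Y i w)%:E = \prod_(i <- s) \int[P]_w (Y i w)%:E)%E.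
Proof.
move=> mY Y0 Yfin Yind us.
have mYB i B : measurable B -> measurable (Y i @^-1` B).
  by move=> mB; rewrite -[X in measurable X]setTI; apply: mY.
have EY0 i : (0 <= \int[P]_w (Y i w)%:E)%E.
  by apply: integral_ge0 => w _; rewrite lee_fin.
have EYf i : (\int[P]_w (Y i w)%:E)%E \is a fin_num by rewrite ge0_fin_numE.
(* The induction carries events on further variables [t]. To treat the head [u] of [s], an arbitrary
   event on [Y u] is moved into [t], which is exactly the hypothesis of [integral_indep_mul]. *)
suff main (t : seq I) (A : I -> set R) : uniq (s ++ t) -> (forall i, measurable (A i)) ->
    (\int[P]_(w in \big[setI/setT]_(i <- t) (Y i @^-1` A i)) (\prod_(i <- s) Y i w)%:E =
     (\prod_(i <- s) \int[P]_w (Y i w)%:E) * \prod_(i <- t) P (Y i @^-1` A i))%E.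
  have := main [::] (fun=> setT); rewrite cats0 !big_nil mule1; exact.
elim: s us t A => [|u s IH] us t A ust mA.
  rewrite big_nil mul1e -Yind //; under eq_integral do rewrite big_nil.
  rewrite integral_cst ?mul1e //.
  by apply: bigsetI_measurable => i _; exact: mYB.
have mD : measurable (\big[setI/setT]_(i <- t) (Y i @^-1` A i)).
  by apply: bigsetI_measurable => i _; exact: mYB.
move: us => /= /andP[us us']; move: ust => /= /andP[].
rewrite mem_cat negb_or => /andP[_ ut] ust.
have fin : ((\prod_(i <- s) \int[P]_w (Y i w)%:E) *
    \prod_(i <- t) P (Y i @^-1` A i))%E \is a fin_num.
  rewrite fin_numM //; apply: prode_fin_num => i _ //.
  by apply: fin_num_measure; exact: mYB.
under eq_integral do rewrite big_cons.
rewrite (@integral_indep_mul _ _ _ (fine ((\prod_(i <- s) \int[P]_w (Y i w)%:E) *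
    \prod_(i <- t) P (Y i @^-1` A i))%E)) //.
- by rewrite fineK // big_cons muleA.
- by apply: measurable_prod => i _.
- by move=> w; apply: prodr_ge0.
move=> B mB; rewrite fineK //.
pose A' i := if i == u then B else A i.
have := IH us' (u :: t) A'; rewrite !big_cons /A' eqxx.
rewrite (eq_big_seq (fun i => Y i @^-1` A i)); last first.
  by move=> i it; case: eqP => // iu; rewrite -iu it in ut.
have -> : (\prod_(j <- t) P (Y j @^-1` (if j == u then B else A j)) =
    \prod_(j <- t) P (Y j @^-1` A j))%E.
  by apply: eq_big_seq => i it; case: eqP => // iu; rewrite -iu it in ut.
rewrite setIC muleCA; apply; last by move=> i; case: ifP.
by rewrite uniq_catC /= mem_cat negb_or ut us uniq_catC.
Qed.

End IndependentProducts.

(** * Sums over injective labellings *)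

Section Occupancy.
Variables (R : comNzRingType) (I : finType) (m : I -> nat).
Implicit Types (A : {set I}) (N : nat) (x : nat -> R).

Definition label_of N (o : option 'I_N) : nat := oapp val 0%N o.

Definition labelling N A (g : {ffun I -> option 'I_N}) : bool :=
  [forall k, isSome (g k) == (k \in A)] &&
  [forall k, forall k', isSome (g k) && (g k == g k') ==> (k == k')].

Lemma labellingP N A (g : {ffun I -> option 'I_N}) :
  reflect ((forall k, isSome (g k) = (k \in A)) /\
           forall k k' i, g k = Some i -> g k' = Some i -> k = k')
          (labelling A g).
Proof.
apply: (iffP andP) => -[gA ginj]; split.
- by move=> k; apply/eqP; move/forallP: gA.
- move=> k k' i gk gk'; move/forallP/(_ k)/forallP/(_ k'): ginj.
  by rewrite gk gk' eqxx => /eqP.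
- by apply/forallP => k; rewrite gA.
- apply/forallP => k; apply/forallP => k'; apply/implyP => /andP[].
  case gk: (g k) => [i|//] _ /eqP gk'.
  by apply/eqP; apply: ginj gk (esym gk').
Qed.

Definition weight A : nat := \sum_(k in A) m k.

Lemma weightD1 A j : j \in A -> weight A = (m j + weight (A :\ j))%N.
Proof. by move=> jA; rewrite /weight (big_setD1 j). Qed.

(* A labelling of A is [None] outside A, so that distinct terms of the sum
   come from distinct injections of A into the labels below N. *)
Definition occupancy N x A : R :=
  \sum_(g : {ffun I -> option 'I_N} | labelling A g)
    \prod_(k in A) x (label_of (g k)) ^+ m k.

Lemma occupancy0 x A : occupancy 0 x A = (A == finset.set0)%:R.
Proof.
rewrite /occupancy; have [->|A0] := eqVneq A finset.set0.
  rewrite (big_pred1 [ffun=> None]) ?big_set0 // => g.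
  have -> : g = [ffun=> None] by apply/ffunP => k; rewrite ffunE; case: (g k) => [[]|].
  by rewrite /= eqxx; apply/labellingP; split => [k|k k' i]; rewrite !ffunE ?finset.inE.
rewrite big_pred0 // => g; apply/negbTE/negP => /labellingP[gA _].
case/set0Pn: A0 => k; rewrite -gA; case: (g k) => [[]|] //.
Qed.

Lemma occupancy_scale N x A c :
  occupancy N (fun i => c * x i) A = c ^+ weight A * occupancy N x A.
Proof.
rewrite /occupancy mulr_sumr; apply: eq_bigr => g _.
under eq_bigr do rewrite exprMn; rewrite big_split /=; congr (_ * _).
by rewrite /weight (big_morph _ (exprD c) (expr0 c)).
Qed.

Lemma occupancy_ext N x y A : x =1 y -> occupancy N x A = occupancy N y A.
Proof.
by move=> xy; apply: eq_bigr => g _; apply: eq_bigr => k _; rewrite xy.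
Qed.

(** A labelling by [N.+1] labels amounts to the element that holds label 0, if any, and a labelling
    of the others by labels lowered by one. These maps realise the bijection behind [occupancyS]. *)
Let insert0 N (o : option I) (g : {ffun I -> option 'I_N}) : {ffun I -> option 'I_N.+1} :=
  [ffun k => if o == Some k then Some ord0 else omap (lift ord0) (g k)].
Let remove0 N (g : {ffun I -> option 'I_N.+1}) : {ffun I -> option 'I_N} :=
  [ffun k => obind (unlift ord0) (g k)].
Let zero_of N (g : {ffun I -> option 'I_N.+1}) : option I :=
  [pick k | g k == Some ord0].

Let zero_ofP N A (g : {ffun I -> option 'I_N.+1}) o : labelling A g ->
  (zero_of g == o) = [forall k, (g k == Some ord0) == (o == Some k)].
Proof.
move=> /labellingP[gA ginj]; rewrite /zero_of; apply/eqP/forallP.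
  move=> <- k; case: pickP => [k' /eqP gk'|g0]; last by rewrite g0.
  apply/eqP; apply/eqP/eqP => [gk|[<-//]]; congr Some; exact: ginj gk' gk.
move=> g0; case: pickP => [k gk|gN].
  by have := g0 k; rewrite gk => /eqP/esym/eqP.
by case: o g0 => // k /(_ k); rewrite gN eqxx.
Qed.

Let insert0K N A o (g : {ffun I -> option 'I_N.+1}) :
  labelling A g -> zero_of g == o -> insert0 o (remove0 g) = g.
Proof.
move=> gA; rewrite (zero_ofP _ gA) => /forallP g0; apply/ffunP => k; rewrite !ffunE.
rewrite -(eqP (g0 k)); case: eqP => [->//|]; case: (g k) => //= i.
by case: unliftP => [j ->|->].
Qed.

(** The left side is the condition that [reindex_onto] leaves in [occupancyS]. *)
Let fiber_insert0 N A o (g : {ffun I -> option 'I_N}) :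
  (labelling A (insert0 o g) && (zero_of (insert0 o g) == o)) &&
    (remove0 (insert0 o g) == g) =
  (if o is Some j then j \in A else true) &&
    labelling (if o is Some j then A :\ j else A) g.
Proof.
apply/andP/andP => [[/andP[lA z] /eqP rK]|[oA /labellingP[gA ginj]]].
  have /labellingP[iA iinj] := lA.
  have gN k : o = Some k -> g k = None.
    by move=> ok; rewrite -rK !ffunE ok eqxx /= unlift_none.
  split; first by case: o iA {iinj lA z rK gN} => // j /(_ j); rewrite ffunE eqxx => <-.
  apply/labellingP; split=> [k|k k' i gk gk'].
    have := iA k; rewrite ffunE; case: eqP => [ok _|ok].
      by rewrite gN // ok !inE eqxx.
    case: (g k) => [i|] /= ->; case: o ok {iA iinj lA z rK gN} => // j jk.
      by rewrite !inE; case: eqP jk => // ->.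
    by rewrite !inE; case: eqP jk => // ->.
  apply: (iinj k k' (lift ord0 i)); rewrite ffunE.
    by case: eqP => [/gN|]; rewrite gk.
  by case: eqP => [/gN|]; rewrite gk'.
have gN k : o = Some k -> g k = None.
  by move=> ok; have := gA k; rewrite ok !inE eqxx; case: (g k).
have lA : labelling A (insert0 o g).
  apply/labellingP; split => [k|k k' i]; rewrite !ffunE.
    case: eqP => [ok|ok]; first by rewrite ok in oA; rewrite oA.
    rewrite (_ : isSome _ = isSome (g k)); last by case: (g k).
    rewrite gA; case: o ok {gN oA gA} => // j jk; rewrite !inE.
    by case: eqP jk => // ->.
  case: eqP => [ok [<-]|ok]; case: eqP => [ok'|ok'].
  - by rewrite ok in ok'; case: ok'.
  - by case: (g k') => [i'|] //= [].
  - by case: (g k) => [i'|] //= [<-] [].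
  - case gk: (g k) => [i'|] //= [<-]; case gk': (g k') => [i''|] //= [].
    rewrite !add0n => /val_inj e.
    by apply: ginj gk _; rewrite gk' e.
split; last first.
  apply/eqP/ffunP => k; rewrite !ffunE; case: eqP => [/gN->|_] /=.
    by rewrite unlift_none.
  by case: (g k) => //= i; rewrite liftK.
rewrite lA (zero_ofP _ lA); apply/forallP => k; rewrite !ffunE.
by case: (o == Some k); rewrite ?eqxx //; case: (g k).
Qed.

(** Labellings are sorted by the element [j] with label 0; the first term collects those in which no
    element has it. *)
Lemma occupancyS N x A : occupancy N.+1 x A =
  occupancy N (x \o succn) A +
  \sum_(j in A) x 0%N ^+ m j * occupancy N (x \o succn) (A :\ j).
Proof.
rewrite /occupancy.
transitivity (\sum_(o : option I) \sum_(g | (if o is Some j then j \in A else true) &&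
    labelling (if o is Some j then A :\ j else A) g)
    \prod_(k in A) x (label_of (@insert0 N o g k)) ^+ m k).
  rewrite (partition_big (@zero_of N) xpredT) //=; apply: eq_bigr => o _.
  rewrite (reindex_onto (insert0 o) (@remove0 N)) /=; last first.
    by move=> g /andP[lA z]; exact: insert0K lA z.
  by apply: eq_bigl => g; rewrite fiber_insert0.
have label_lift k (g : {ffun I -> option 'I_N}) : isSome (g k) ->
    label_of (omap (lift ord0) (g k)) = (label_of (g k)).+1.
  by case: (g k) => //= i _; rewrite /bump leq0n.
rewrite (bigD1 None) //=; congr (_ + _).
  apply: eq_bigr => g /labellingP[gA _]; apply: eq_bigr => k kA.
  by rewrite ffunE /= label_lift ?gA.
rewrite (reindex_omap Some id) => [|[]//]; rewrite big_mkcond [RHS]big_mkcond /=.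
apply: eq_bigr => j _; rewrite eqxx.
case: ifPn => jA /=; last by rewrite big_pred0.
rewrite mulr_sumr; apply: eq_bigr => g /labellingP[gA _].
rewrite (big_setD1 j) //= ffunE eqxx; congr (_ * _).
apply: eq_bigr => k kA; rewrite ffunE ifN ?label_lift ?gA //.
by move: kA; rewrite !inE => /andP[kj _]; apply: contra kj => /eqP[->].
Qed.

(** Stick breaking is the case [v = 1 - u]. Two separate sequences allow for the absolute values of
    [z] and of [1 - z]. *)
Definition sticks (u v : nat -> R) (i : nat) : R := u i * \prod_(j < i) v j.

(** After the first stick, the rest of the vector is [v 0] times a vector of the same kind, and
    [occupancy] is homogeneous of degree [weight]. *)
Lemma occupancy_sticks N u v A : occupancy N.+1 (sticks u v) A =
  v 0%N ^+ weight A * occupancy N (sticks (u \o succn) (v \o succn)) A +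
  \sum_(j in A) u 0%N ^+ m j * v 0%N ^+ weight (A :\ j) *
    occupancy N (sticks (u \o succn) (v \o succn)) (A :\ j).
Proof.
have shift : (sticks u v) \o succn =1
    fun i => v 0%N * sticks (u \o succn) (v \o succn) i.
  by move=> i; rewrite /sticks /= big_ord_recl mulrCA.
rewrite occupancyS (occupancy_ext _ _ shift) occupancy_scale; congr (_ + _).
apply: eq_bigr => j _.
by rewrite (occupancy_ext _ _ shift) occupancy_scale /sticks big_ord0 mulr1 mulrA.
Qed.

End Occupancy.

(** * The Ewens formula *)

Section OccupancyMonotone.
Variables (R : realDomainType) (I : finType) (m : I -> nat).

(** Composition with [f] embeds the labellings of one sum into those of the other with equal terms,
    and the terms left over are nonnegative. This serves both for monotonicity in [N] and for
    invariance under permutations. *)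
Lemma le_occupancy (N N' : nat) (f : 'I_N -> 'I_N') (x x' : nat -> R) (A : {set I}) :
  injective f -> (forall i : 'I_N, x i = x' (f i)) -> (forall i, 0 <= x' i) ->
  occupancy m N x A <= occupancy m N' x' A.
Proof.
move=> f_inj xf x'0; rewrite /occupancy.
pose h (g : {ffun I -> option 'I_N}) : {ffun I -> option 'I_N'} :=
  [ffun k => omap f (g k)].
have h_inj : injective h.
  move=> g g' /ffunP e; apply/ffunP => k; have := e k; rewrite !ffunE.
  by case: (g k) (g' k) => [i|] [i'|] //= [/f_inj->].
have lab_h g : labelling A g -> labelling A (h g).
  move=> /labellingP[gA ginj]; apply/labellingP; split => [k|k k' i]; rewrite !ffunE.
    by rewrite -gA; case: (g k).
  case gk: (g k) => [a|] //= [<-]; case gk': (g k') => [b|] //= [/f_inj e].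
  by apply: ginj gk _; rewrite gk' e.
set L := [set g in @labelling I N A]%SET.
rewrite (eq_bigl (mem L)); last by move=> g; rewrite /= inE.
apply: (@le_trans _ _ (\sum_(g' in [set h g | g in L]%SET)
    \prod_(k in A) x' (label_of (g' k)) ^+ m k)).
  rewrite big_imset /=; last by move=> g g' _ _; exact: h_inj.
  rewrite le_eqVlt; apply/orP; left; apply/eqP; apply: eq_bigr => g.
  rewrite inE => /labellingP[gA _]; apply: eq_bigr => k; rewrite -gA ffunE.
  by case: (g k) => //= i _; rewrite xf.
rewrite [leRHS](bigID (fun g' => g' \in [set h g | g in L]%SET)) /=.
rewrite -[leLHS]addr0 lerD //; last first.
  by apply: sumr_ge0 => g _; apply: prodr_ge0 => k _; rewrite exprn_ge0.
rewrite le_eqVlt; apply/orP; left; apply/eqP; apply: eq_bigl => g'.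
apply/imsetP/andP => [[g + ->]|[_ /imsetP //]].
by rewrite inE => gL; split; [exact: lab_h | apply: imset_f; rewrite inE].
Qed.

End OccupancyMonotone.

Section MeanOccupancy.
Variables (R : realType) (I : finType) (m : I -> nat).
Implicit Types (A : {set I}) (N : nat).

(** The integral of x^a (1 - x)^b over the unit interval. *)
Definition beta_int (a b : nat) : R := (a`! * b`!)%:R / (a + b).+1`!%:R.

(* The value of E[occupancy m N (sticks U (1 - U)) A] for U a sequence of
   independent uniform variables: the recursion peels off the first stick. *)
Fixpoint mean_occupancy N A : R :=
  if N is N'.+1 then
    beta_int 0 (weight m A) * mean_occupancy N' A +
    \sum_(j in A) beta_int (m j) (weight m (A :\ j)) * mean_occupancy N' (A :\ j)
  else (A == finset.set0)%:R.

Definition ewens A : R := (\prod_(k in A) (m k).-1`!)%:R / (weight m A)`!%:R.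

Lemma beta_int_ge0 a b : 0 <= beta_int a b.
Proof. by rewrite /beta_int mulr_ge0 ?invr_ge0. Qed.

Lemma beta_int0 b : beta_int 0 b = b.+1%:R^-1.
Proof.
by rewrite /beta_int fact0 mul1n add0n factS natrM invfM mulrA mulrAC divff ?mul1r.
Qed.

Hypothesis m_gt0 : forall k, (0 < m k)%N.

(** With M the weight of [A], the first term is the share 1/(M+1) of [ewens A] and the term of [j]
    is the share [m j]/(M+1), by cancellation of factorials. The shares add up to 1. *)
Lemma ewensE A : ewens A = beta_int 0 (weight m A) * ewens A +
  \sum_(j in A) beta_int (m j) (weight m (A :\ j)) * ewens (A :\ j).
Proof.
have fact_neq0 n : n`!%:R != 0 :> R by rewrite pnatr_eq0 -lt0n fact_gt0.
have term j : j \in A -> beta_int (m j) (weight m (A :\ j)) * ewens (A :\ j) =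
    (m j)%:R * ((\prod_(k in A) (m k).-1`!)%:R / (weight m A).+1`!%:R).
  move=> jA; rewrite /beta_int /ewens -(weightD1 _ jA) (big_setD1 j jA) /=.
  have -> : (m j)`! = (m j * (m j).-1`!)%N by rewrite -{1}(prednK (m_gt0 j)) factS prednK.
  have := fact_neq0 (weight m (A :\ j)); have := fact_neq0 (weight m A).+1.
  move: ((weight m A).+1`!) ((weight m (A :\ j))`!) => a b a0 b0.
  by rewrite !natrM; field; rewrite a0 b0.
rewrite (eq_bigr _ term) -mulr_suml -natr_sum -/(weight m A) beta_int0 /ewens.
rewrite factS natrM -natr1.
have := fact_neq0 (weight m A); have : (weight m A)%:R + 1 != 0 :> R by rewrite natr1 pnatr_eq0.
move: ((weight m A)`!%:R) (weight m A)%:R => a b b0 a0.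
by field; rewrite a0 b0.
Qed.

Lemma ewens_ge0 A : 0 <= ewens A.
Proof. by rewrite /ewens mulr_ge0 ?invr_ge0. Qed.

Lemma ewens0 : ewens finset.set0 = 1.
Proof. by rewrite /ewens /weight !big_set0 fact0 divr1. Qed.

(** By [ewensE], [ewens] is a fixed point of the recursion, whose coefficients are nonnegative, and
    it dominates the starting values. *)
Lemma mean_occupancy_le N A : mean_occupancy N A <= ewens A.
Proof.
elim: N A => [|N IH] A /=.
  by case: eqP => [->|_] /=; rewrite ?ewens0 ?ewens_ge0.
rewrite [leRHS]ewensE lerD //; first by rewrite ler_wpM2l ?beta_int_ge0.
by apply: ler_sum => j _; rewrite ler_wpM2l ?beta_int_ge0.
Qed.

Lemma mean_occupancy_ge0 N A : 0 <= mean_occupancy N A.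
Proof.
elim: N A => [|N IH] A //=.
rewrite addr_ge0 ?mulr_ge0 ?beta_int_ge0 //.
by apply: sumr_ge0 => j _; rewrite mulr_ge0 ?beta_int_ge0.
Qed.

Lemma mean_occupancy_nd A : nondecreasing_seq (mean_occupancy ^~ A).
Proof.
apply/nondecreasing_seqP => N; elim: N A => [|N IH] A; last first.
  rewrite [leLHS]/= [leRHS]/= -/(mean_occupancy N.+1) lerD //.
    by rewrite ler_wpM2l ?beta_int_ge0 // IH.
  by apply: ler_sum => j _; rewrite ler_wpM2l ?beta_int_ge0 // IH.
rewrite [leLHS]/=; case: eqP => [->|_]; last exact: mean_occupancy_ge0.
by rewrite /= big_set0 addr0 eqxx mulr1 beta_int0 /weight big_set0 invr1.
Qed.

(** The limit exists by monotonicity and boundedness. By induction on the cardinality of [A], it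
    solves the same affine equation as [ewens A]. *)
Lemma mean_occupancy_cvg A : mean_occupancy ^~ A @ \oo --> ewens A.
Proof.
have cvgA B : cvgn (mean_occupancy ^~ B).
  apply: nondecreasing_is_cvgn; first exact: mean_occupancy_nd.
  by exists (ewens B) => _ [N _ <-]; exact: mean_occupancy_le.
elim: {A}#|A| {-2}A (leqnn #|A|) => [|c IH] A.
  rewrite leqn0 cards_eq0 => /eqP->; rewrite ewens0.
  apply: cvg_near_cst; apply: nearW => N; elim: N => [|N IH] /=; first by rewrite eqxx.
  by rewrite IH big_set0 addr0 mulr1 beta_int0 /weight big_set0 invr1.
move=> Ac; have [A0|An0] := eqVneq A finset.set0; first by apply: IH; rewrite A0 cards0.
set l := limn (mean_occupancy ^~ A).
have lE : l = beta_int 0 (weight m A) * l +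
    \sum_(j in A) beta_int (m j) (weight m (A :\ j)) * ewens (A :\ j).
  have lS : mean_occupancy n.+1 A @[n --> \oo] --> l.
    by rewrite (cvg_shiftS (mean_occupancy ^~ A)); exact: cvgA.
  rewrite -[LHS](cvg_lim _ lS) //; apply/cvg_lim => //=.
  apply: cvgD; first by apply: cvgMl_tmp; exact: cvgA.
  apply: cvg_big => [|j jA]; first exact: add_continuous.
  apply: cvgMl_tmp; apply: IH.
  by rewrite -ltnS (leq_trans _ Ac) // [X in (_ < X)%N](cardsD1 j) jA.
suff -> : ewens A = l by exact: cvgA.
(* The coefficient of the unknown is 1/(M+1) with M positive, as [A] is nonempty; the equation
   therefore has a single solution. *)
have b1 : 1 - beta_int 0 (weight m A) != 0.
  rewrite beta_int0 subr_eq0 eq_sym invr_eq1 pnatr_eq1 eqSS -lt0n.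
  by have /set0Pn[j jA] := An0; rewrite (weightD1 _ jA) addn_gt0 m_gt0.
apply: (mulfI b1); have := ewensE A; move: lE.
set B := beta_int 0 _; set S := \sum_(j in A) _ => e1 e2.
have -> : (1 - B) * l = S by rewrite mulrBl mul1r {1}e1; ring.
by rewrite mulrBl mul1r {1}e2; ring.
Qed.

End MeanOccupancy.

(** * Laws of random sequences *)

Section SequenceLaws.
Variable R : realType.

(** These generators of [real_sequence_events] are named in order to make the space of sequences a
    measurable type. *)
Definition coordinate_events : set (set (nat -> R)) :=
  [set A | exists i : nat, exists2 B : set R, measurable B & A = [set x | B (x i)]].

Notation sequence_space := (g_sigma_algebraType coordinate_events).

Lemma measurable_coordinate i :
  measurable_fun [set: sequence_space] (fun x : sequence_space => (x : nat -> R) i).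
Proof.
move=> _ B mB; rewrite setTI; apply: sub_gen_smallest.
by exists i, B.
Qed.

Lemma measurable_random_sequence (d : measure_display) (O : measurableType d)
    (X : O -> nat -> R) : random_sequence X ->
  measurable_fun [set: O] (X : O -> sequence_space).
Proof.
move=> mX; apply: (@measurability _ _ O sequence_space setT X coordinate_events) => //.
by move=> _ [_ [i [B mB ->]] <-]; exact: mX.
Qed.

Lemma real_sequence_events_preimage (f : (nat -> R) -> R) (B : set R) :
  measurable_fun [set: sequence_space] f -> measurable B ->
  real_sequence_events (f @^-1` B).
Proof. by move=> mf mB; rewrite -[_ @^-1` _]setTI; exact: mf. Qed.

Lemma same_law_integral (d1 d2 : measure_display) (O1 : measurableType d1)
    (O2 : measurableType d2) (P1 : probability O1 R) (P2 : probability O2 R)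
    (X1 : O1 -> nat -> R) (X2 : O2 -> nat -> R) (f : (nat -> R) -> R) :
  random_sequence X1 -> random_sequence X2 ->
  same_law (@real_sequence_events R) P1 X1 P2 X2 ->
  measurable_fun [set: sequence_space] f -> (forall x, 0 <= f x) ->
  (\int[P1]_w (f (X1 w))%:E = \int[P2]_w (f (X2 w))%:E)%E.
Proof.
move=> /measurable_random_sequence mX1 /measurable_random_sequence mX2 X12 mf f0.
pose Y1 : {RV P1 >-> sequence_space} := HB.pack (X1 : O1 -> sequence_space)
  (isMeasurableFun.Build _ _ _ _ _ mX1).
pose Y2 : {RV P2 >-> sequence_space} := HB.pack (X2 : O2 -> sequence_space)
  (isMeasurableFun.Build _ _ _ _ _ mX2).
have mEf : measurable_fun [set: sequence_space] (EFin \o f) by exact/measurable_EFinP.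
have Ef0 (x : sequence_space) : (0 <= (EFin \o f) x)%E by rewrite lee_fin.
rewrite -(@ge0_integral_distribution _ _ _ _ _ P1 Y1 (EFin \o f) mEf Ef0).
rewrite -(@ge0_integral_distribution _ _ _ _ _ P2 Y2 (EFin \o f) mEf Ef0).
by apply: eq_measure_integral => A mA _; exact: X12.
Qed.

(** The absolute values make the integrand nonnegative everywhere, whereas a split vector is
    nonnegative only almost surely. *)
Lemma measurable_monomial (I : finType) (m l : I -> nat) (A : {set I}) :
  measurable_fun [set: sequence_space]
    (fun x : nat -> R => \prod_(k in A) `|x (l k)| ^+ m k).
Proof.
rewrite (_ : (fun x => _) = fun x : sequence_space =>
    \prod_k (if k \in A then `|(x : nat -> R) (l k)| ^+ m k else 1)); last first.
  by apply/funext => x; rewrite big_mkcond.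
apply: measurable_prod => k _; case: (k \in A); last exact: measurable_cst.
apply: measurable_funX; apply: measurableT_comp; first exact: normr_measurable.
exact: measurable_coordinate.
Qed.

Lemma measurable_occupancy (I : finType) (m : I -> nat) N (A : {set I}) :
  measurable_fun [set: sequence_space]
    (fun x : nat -> R => occupancy m N (fun i => `|x i|) A).
Proof.
rewrite /occupancy (_ : (fun x => _) = fun x : sequence_space =>
    \sum_g (if labelling A g then
      \prod_(k in A) `|(x : nat -> R) (@label_of N (g k))| ^+ m k else 0)); last first.
  by apply/funext => x; rewrite big_mkcond.
apply: measurable_sum => g; case: (labelling A g); last exact: measurable_cst.
exact: (measurable_monomial m (fun k => label_of (g k))).
Qed.

Lemma occupancy_ge0 (I : finType) (m : I -> nat) N (x : nat -> R) (A : {set I}) :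
  (forall i, 0 <= x i) -> 0 <= occupancy m N x A.
Proof.
by move=> x0; apply: sumr_ge0 => g _; apply: prodr_ge0 => k _; rewrite exprn_ge0.
Qed.

End SequenceLaws.

(** * Mean occupancy for independent uniform sticks *)

Section UniformSticks.
Context (R : realType) (d : measure_display) (O : measurableType d).
Context (P : probability O R) (Z : nat -> {RV P >-> R}).
Hypothesis Z_indep :
  mutually_independent P (fun B : set R => measurable B) (fun j => Z j : O -> R).
Hypothesis Z_beta : forall j (B : set R), measurable B ->
  distribution P (Z j) B = beta_law 1 1 B.

Let U j w : R := `|Z j w|.
Let V j w : R := `|1 - Z j w|.

Lemma beta_law11 (B : set R) : measurable B ->
  beta_law 1 1 B = uniform_prob (@ltr01 R) B.
Proof.
move=> mB; have mass (A : set R) : measurable A ->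
    beta_mass 1 1 A = uniform_prob (@ltr01 R) A.
  move=> mA; rewrite /uniform_prob integral_uniform_pdf /beta_mass.
  apply: eq_integral => x; rewrite inE => -[_ /=]; rewrite in_itv /= => x01.
  by rewrite /beta_weight /uniform_pdf x01 subrr !powRr0 mulr1 subr0 invr1.
by rewrite /beta_law !mass // probability_setT /= invr1 mule1.
Qed.

Lemma integral_stick j a b :
  (\int[P]_w (U j w ^+ a * V j w ^+ b)%:E = (beta_int R a b)%:E)%E.
Proof.
pose f (x : R) := `|x| ^+ a * `|1 - x| ^+ b.
have mf : measurable_fun [set: R] f.
  apply: measurable_funM; apply: measurable_funX; first exact: normr_measurable.
  apply: measurableT_comp; first exact: normr_measurable.
  exact: measurable_funB.
have f0 x : (0 <= (EFin \o f) x)%E by rewrite lee_fin mulr_ge0 ?exprn_ge0.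
(* [uniform_prob] lives on [measurableTypeR R], whose display differs from that
   of [R] although the measurable sets are the same. *)
have mZ : measurable_fun [set: O] (Z j : O -> measurableTypeR R).
  exact: (measurable_funPT (Z j)).
pose Zj : {RV P >-> measurableTypeR R} := HB.pack (Z j : O -> measurableTypeR R)
  (isMeasurableFun.Build _ _ _ _ _ mZ).
have mEf : measurable_fun [set: measurableTypeR R] (EFin \o f).
  by apply/measurable_EFinP; exact: mf.
rewrite -[LHS](@ge0_integral_distribution _ _ _ _ _ P Zj (EFin \o f) mEf f0).
transitivity (\int[uniform_prob (@ltr01 R)]_x (EFin \o f) x)%E.
  by apply: eq_measure_integral => A mA _; rewrite [LHS]Z_beta // beta_law11.
rewrite integral_uniform //.
rewrite subr0 invr1 mul1e /beta_int -beta_fun_fact EFin_beta_fun /=.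
rewrite integral_XMonemX_restrict setTI; apply: eq_integral => x; rewrite inE /= in_itv /= => /andP[x0 x1].
by rewrite /f /XMonemX !ger0_norm // subr_ge0.
Qed.

Let mU j : measurable_fun [set: O] (U j).
Proof. by apply: measurableT_comp; first exact: normr_measurable. Qed.

Let mV j : measurable_fun [set: O] (V j).
Proof.
apply: measurableT_comp; first exact: normr_measurable.
exact: measurable_funB.
Qed.

Let stick_prod (a b : nat -> nat) r w : R :=
  \prod_(i < r) (U i w ^+ a i * V i w ^+ b i).

Lemma integral_stick_prod (a b : nat -> nat) r :
  (\int[P]_w (stick_prod a b r w)%:E = (\prod_(i < r) beta_int R (a i) (b i))%:E)%E.
Proof.
pose Y j w := U j w ^+ a j * V j w ^+ b j.
rewrite /stick_prod; under eq_integral do rewrite -(big_mkord xpredT (fun i => Y i _)).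
rewrite integral_prod_independent ?iota_uniq //.
- rewrite big_mkord -prodEFin; apply: eq_bigr => i _; exact: integral_stick.
- by move=> i; apply: measurable_funM; apply: measurable_funX; [exact: mU|exact: mV].
- by move=> i w; rewrite /Y mulr_ge0 ?exprn_ge0 ?normr_ge0.
- by move=> i; rewrite integral_stick ltry.
move=> s A us mA.
pose A' i := [set x : R | A i (`|x| ^+ a i * `|1 - x| ^+ b i)].
apply: (Z_indep (A := A') us) => i.
have mf : measurable_fun [set: R] (fun x => `|x| ^+ a i * `|1 - x| ^+ b i).
  apply: measurable_funM; apply: measurable_funX; first exact: normr_measurable.
  apply: measurableT_comp; first exact: normr_measurable.
  exact: measurable_funB.
by have := mf measurableT _ (mA i); rewrite setTI.
Qed.

Let tail_occupancy (I : finType) (m : I -> nat) N r (A : {set I}) w : R :=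
  occupancy m N (sticks (fun i => U (r + i) w) (fun i => V (r + i) w)) A.

Let stick_prod_ge0 a b r w : 0 <= stick_prod a b r w.
Proof. by apply: prodr_ge0 => i _; rewrite mulr_ge0 ?exprn_ge0 ?normr_ge0. Qed.

Let measurable_stick_prod a b r : measurable_fun [set: O] (stick_prod a b r).
Proof.
by apply: measurable_prod => i _; apply: measurable_funM; apply: measurable_funX;
  [exact: mU | exact: mV].
Qed.

Let sticks_ge0 r w i : 0 <= sticks (fun i => U (r + i) w) (fun i => V (r + i) w) i.
Proof. by rewrite mulr_ge0 ?normr_ge0 //; apply: prodr_ge0 => j _; exact: normr_ge0. Qed.

Let tail_occupancy_ge0 I m N r A w : 0 <= @tail_occupancy I m N r A w.
Proof. by apply: occupancy_ge0 => i; exact: sticks_ge0. Qed.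

Let measurable_tail_occupancy I m N r A :
  measurable_fun [set: O] (@tail_occupancy I m N r A).
Proof.
pose X w := sticks (fun i => U (r + i) w) (fun i => V (r + i) w).
have mX : random_sequence X.
  move=> i; apply: measurable_funM; first exact: mU.
  by apply: measurable_prod => j _; exact: mV.
rewrite (_ : tail_occupancy _ _ _ _ =
    (fun x => occupancy m N (fun i => `|x i|) A) \o X).
  exact: measurableT_comp (measurable_occupancy m N A) (measurable_random_sequence mX).
apply/funext => w; apply: occupancy_ext => i.
by rewrite ger0_norm // sticks_ge0.
Qed.

(** The induction allows for [r] sticks already peeled off, with arbitrary exponents. Each step
    moves stick [r] from the tail into the product, so that in the end only the mean of a product of
    independent monomials is left. *)
Lemma integral_occupancy_sticks (I : finType) (m : I -> nat) N r
    (a b : nat -> nat) (A : {set I}) :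
  (\int[P]_w (stick_prod a b r w * tail_occupancy m N r A w)%:E =
   (\prod_(i < r) beta_int R (a i) (b i) * mean_occupancy R m N A)%:E)%E.
Proof.
elim: N r a b A => [|N IH] r a b A.
  rewrite /tail_occupancy; under eq_integral do rewrite occupancy0 EFinM.
  rewrite ge0_integralZr //=.
  - by rewrite integral_stick_prod -EFinM.
  - exact/measurable_EFinP.
  - by move=> w _; rewrite lee_fin.
(* [upd f c] keeps the exponents of the first [r] sticks and gives exponent [c] to stick [r]. *)
pose upd (f : nat -> nat) c i := if (i < r)%N then f i else c.
have upd_prod a' b' : \prod_(i < r.+1) beta_int R (upd a a' i) (upd b b' i) =
    \prod_(i < r) beta_int R (a i) (b i) * beta_int R a' b'.
  rewrite big_ord_recr /= /upd ltnn; congr (_ * _).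
  by apply: eq_bigr => i _; rewrite ltn_ord.
pose G a' b' B w := stick_prod (upd a a') (upd b b') r.+1 w *
  tail_occupancy m N r.+1 B w.
have GE a' b' B w : stick_prod a b r w * (U r w ^+ a' * V r w ^+ b' *
    tail_occupancy m N r.+1 B w) = G a' b' B w.
  rewrite /G /stick_prod big_ord_recr /= /upd ltnn !mulrA; congr (_ * _ * _ * _).
  by apply: eq_bigr => i _; rewrite ltn_ord.
have intG a' b' B : (\int[P]_w (G a' b' B w)%:E =
    (\prod_(i < r) beta_int R (a i) (b i) * (beta_int R a' b' * mean_occupancy R m N B))%:E)%E.
  by rewrite IH upd_prod mulrA.
have mG a' b' B : measurable_fun [set: O] (fun w => (G a' b' B w)%:E).
  by apply/measurable_EFinP; apply: measurable_funM.
have G0 a' b' B w : (0 <= (G a' b' B w)%:E)%E by rewrite lee_fin mulr_ge0.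
have peel w : (stick_prod a b r w * tail_occupancy m N.+1 r A w)%:E =
    ((G 0%N (weight m A) A w)%:E +
     \sum_(j <- enum A) (G (m j) (weight m (A :\ j)) (A :\ j) w)%:E)%E.
  rewrite sumEFin -EFinD /tail_occupancy occupancy_sticks; congr _%:E.
  have tailE B : occupancy m N (sticks ((fun i => U (r + i) w) \o succn)
      ((fun i => V (r + i) w) \o succn)) B = tail_occupancy m N r.+1 B w.
    apply: occupancy_ext => i; rewrite /sticks /= addSnnS; congr (_ * _).
    by apply: eq_bigr => k _; rewrite addSnnS.
  rewrite tailE mulrDr big_enum addn0; congr (_ + _).
    by rewrite -GE expr0 mul1r.
  by rewrite mulr_sumr; apply: eq_bigr => j _; rewrite -GE tailE.
under eq_integral do rewrite peel.
rewrite ge0_integralD //; last 2 first.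
- by move=> w _; apply: sume_ge0.
- exact: emeasurable_sum.
rewrite ge0_integral_sum // intG (eq_bigr _ (fun j _ => intG _ _ _)).
by rewrite sumEFin -EFinD -mulr_sumr -mulrDr big_enum.
Qed.

End UniformSticks.

Section GEM.
Context (R : realType).

Lemma normr_stick_breaking (z : nat -> R) i :
  `|stick_breaking z i| = sticks (fun i => `|z i|) (fun i => `|1 - z i|) i.
Proof. by rewrite /stick_breaking normrM normr_prod. Qed.

Lemma GEM_occupancy (d : measure_display) (O : measurableType d)
    (P : probability O R) (X : O -> nat -> R) (I : finType) (m : I -> nat) N
    (A : {set I}) : GEM_distributed 0 1 P X ->
  (\int[P]_w (occupancy m N (fun i => `|X w i|) A)%:E = (mean_occupancy R m N A)%:E)%E.
Proof.
move=> [mX [d' [Om [P' [Z [Zind Zlaw XZ]]]]]].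
have mZ : random_sequence (fun w => stick_breaking (fun j => Z j w)).
  move=> i; apply: measurable_funM => //.
  by apply: measurable_prod => j _; exact: measurable_funB.
have f0 x : 0 <= occupancy m N (fun i => `|x i : R|) A.
  by apply: occupancy_ge0 => i; exact: normr_ge0.
rewrite (same_law_integral mX mZ XZ (measurable_occupancy m N A) f0).
have Zlaw' j B : measurable B -> distribution P' (Z j) B = beta_law 1 1 B.
  by move=> mB; rewrite Zlaw // mulr0 subr0 addr0.
have := integral_occupancy_sticks Zind Zlaw' m N 0 id id A.
rewrite big_ord0 mul1r => <-; apply: eq_integral => w _.
rewrite big_ord0 mul1r; congr _%:E; apply: occupancy_ext => i.
exact: normr_stick_breaking.
Qed.

End GEM.

(** * Sizes of subtrees *)

Section Blocks.
Variables (R : realType) (p : nat -> nat) (n : nat).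
Hypothesis p_le : forall k, (p k <= k)%N.

(** The list [0 :: map succn (chain p j)] enumerates the balls on the path from the root to ball
    [j], both ends included. *)
Definition subtree_size (u : nat) : nat :=
  \sum_(j < n.+1) (u \in 0%N :: map succn (chain p j)).

(* Multiplicity of the step to ball k+1 on the paths of the first n+1 balls. *)
Definition passages (k : 'I_n) : nat := \sum_(j < n.+1) (val k \in chain p j).

Definition block (u : nat) : {set 'I_n} := [set k : 'I_n | p k == u]%SET.

Lemma passagesE k : passages k = subtree_size k.+1.
Proof.
by apply: eq_bigr => j _; rewrite inE /= mem_map //; exact: succn_inj.
Qed.

Lemma subtree_size0 : subtree_size 0 = n.+1.
Proof.
by rewrite /subtree_size (eq_bigr (fun=> 1%N)) ?sum1_card ?card_ord.
Qed.

Lemma passages_gt0 k : (0 < passages k)%N.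
Proof.
have kn : (k.+1 < n.+1)%N by rewrite ltnS.
by rewrite /passages (bigD1 (Ordinal kn)) //= chainS // mem_rcons mem_head.
Qed.

(** A path through ball [u] either goes on to exactly one child of [u] or ends at [u]. *)
Lemma count_chain u j :
  (count (fun k => p k == u) (chain p j) + (j == u) =
   (u \in 0%N :: map succn (chain p j)))%N.
Proof.
elim/ltn_ind: j => -[|j] IH; first by rewrite mem_seq1 add0n eq_sym.
rewrite chainS // -cats1 count_cat /= addn0 IH ?ltnS // map_cat /=.
rewrite -cat_cons mem_cat mem_seq1 [u == _]eq_sym.
case: eqP => [<-|_]; last by rewrite orbF addn0.
rewrite orbT inE /= mem_map; last exact: succn_inj.
by case: (boolP (j \in _)) => // /(mem_chain_lt p_le); rewrite ltnNge p_le.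
Qed.

Lemma weight_block u : (u <= n)%N ->
  (weight passages (block u)).+1 = subtree_size u.
Proof.
move=> un; rewrite /subtree_size.
under eq_bigr do rewrite -count_chain.
have one : (\sum_(j < n.+1) (val j == u) = 1)%N.
  have un1 : (u < n.+1)%N by rewrite ltnS.
  rewrite (bigD1 (Ordinal un1)) //= eqxx big1 // => j ju.
  by apply/eqP; rewrite eqb0; apply: contra ju => /eqP ju; apply/eqP/val_inj.
rewrite big_split /= one addn1; congr _.+1.
rewrite /weight exchange_big /=; apply: eq_bigr => j _.
pose D := [set k in block u | val k \in chain p j]%SET.
transitivity #|D|.
  by rewrite -sum1_card [RHS]big_mkcond [LHS]big_mkcond; apply: eq_bigr => k _;
    rewrite !inE; case: (p k == u) => //; case: (val k \in _).
rewrite -size_filter cardE -(size_map val); apply/perm_size/uniq_perm.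
- by rewrite map_inj_uniq ?enum_uniq //; exact: val_inj.
- by rewrite filter_uniq // uniq_chain.
move=> k; rewrite mem_filter; apply/mapP/andP.
  by move=> [i]; rewrite mem_enum !inE => /andP[pi ij] ->.
move=> [pk kj]; have kn : (k < n)%N.
  by rewrite (leq_trans (mem_chain_lt p_le kj)) // -ltnS.
by exists (Ordinal kn); rewrite // mem_enum !inE pk.
Qed.

(** The numerator that ball [k.+1] contributes to the block of its parent is the denominator of its
    own block. Only the denominator of the root, [n]!, survives. *)
Lemma prod_ewens_block :
  \prod_(u < n.+1) ewens R passages (block u) = n`!%:R^-1.
Proof.
have fact_neq0 k : k`!%:R != 0 :> R by rewrite pnatr_eq0 -lt0n fact_gt0.
rewrite /ewens big_split /=.
have -> : \prod_(u < n.+1) (\prod_(k in block u) (passages k).-1`!)%:R =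
    \prod_(k < n) ((passages k).-1`!)%:R :> R.
  rewrite -natr_prod -natr_prod; congr _%:R.
  rewrite [RHS](partition_big (fun k : 'I_n => inord (p k) : 'I_n.+1) xpredT) //=.
  apply: eq_bigr => u _; apply: eq_bigl => k; rewrite inE -val_eqE /= inordK //.
  by rewrite ltnS (leq_trans (p_le k)) // ltnW.
have -> : \prod_(u < n.+1) (weight passages (block u))`!%:R^-1 =
    n`!%:R^-1 * \prod_(k < n) ((passages k).-1`!)%:R^-1 :> R.
  rewrite big_ord_recl; congr (_ * _).
    by rewrite -[weight _ _]/(_.+1.-1) weight_block // subtree_size0.
  apply: eq_bigr => k _; rewrite -[weight _ _]/(_.+1.-1) weight_block ?passagesE //.
  exact: ltn_ord.
rewrite mulrCA -big_split /= big1 ?mulr1 // => k _.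
by rewrite divff.
Qed.

End Blocks.

(** * Random split trees *)

Section PathProducts.
Variables (R : comNzRingType) (p l : nat -> nat) (n : nat).
Hypothesis p_le : forall k, (p k <= k)%N.

(** The pairs of a ball and a full node it crosses, which index the choices constrained by
    [follows]. *)
Definition path_steps (l : nat -> nat) (n : nat) : seq (nat * node) :=
  [seq (j, take i (addr p l j)) | j <- iota 0 n.+1, i <- iota 0 (size (addr p l j))].

Lemma uniq_path_steps : uniq (path_steps l n).
Proof.
apply: allpairs_uniq_dep => [|j _|]; rewrite ?iota_uniq //.
move=> _ _ /allpairsPdep[j [i [_ ji ->]]] /allpairsPdep[j' [i' [_ ji' ->]]] /=.
rewrite !mem_iota !add0n /= in ji ji' => -[jj' e]; subst j'; congr (Tagged _ _).
by have := congr1 size e; rewrite !size_takel // ltnW.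
Qed.

Lemma prod_path (F : node -> nat -> R) j :
  \prod_(i <- iota 0 (size (addr p l j)))
    F (take i (addr p l j)) (nth 0%N (addr p l j) i) =
  \prod_(k <- chain p j) F (addr p l (p k)) (l k).
Proof.
elim/ltn_ind: j => -[|j] IH; first by rewrite !big_nil.
rewrite addrS // chainS // size_rcons -addn1 iotaD big_cat /= add0n big_seq1.
rewrite -[rcons (chain p _) _]cats1 big_cat big_seq1 -IH ?ltnS //.
rewrite -[rcons _ _]cats1 take_size_cat // nth_cat ltnn subnn /=; congr (_ * _).
apply: eq_big_seq => i; rewrite mem_iota add0n => /= ilt.
by rewrite takel_cat ?nth_cat ?ilt // ltnW.
Qed.

Lemma prod_chain (g : nat -> R) j : (j <= n)%N ->
  \prod_(k <- chain p j) g k = \prod_(k < n) g k ^+ (val k \in chain p j).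
Proof.
move=> jn; rewrite (perm_big [seq k <- iota 0 n | k \in chain p j]) /=; last first.
  apply: uniq_perm; rewrite ?uniq_chain ?filter_uniq ?iota_uniq // => k.
  rewrite mem_filter mem_iota add0n /=; case: (boolP (k \in _)) => //= kj.
  by rewrite (leq_trans (mem_chain_lt p_le kj)).
rewrite big_filter -[X in iota 0 X]subn0 big_mkord big_mkcond.
by apply: eq_bigr => k _; case: (val k \in _); rewrite ?expr1.
Qed.

(** Exchanging the products over balls and over edges turns the number of balls using an edge into
    an exponent; the edges are then grouped by their upper end. *)
Lemma prod_path_steps (F : node -> nat -> R) :
  \prod_(x <- path_steps l n) F x.2 (nth 0%N (addr p l x.1) (size x.2)) =
  \prod_(u < n.+1) \prod_(k in block p n u) F (addr p l u) (l k) ^+ passages p k.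
Proof.
rewrite /path_steps big_allpairs_dep.
transitivity (\prod_(j <- iota 0 n.+1) \prod_(k < n)
    F (addr p l (p k)) (l k) ^+ (val k \in chain p j)).
  apply: eq_big_seq => j; rewrite mem_iota add0n ltnS => /= jn.
  rewrite -(prod_chain (fun k => F (addr p l (p k)) (l k)) jn) -prod_path.
  apply: eq_big_seq => i; rewrite mem_iota add0n => /= ilt.
  by rewrite size_takel // ltnW.
rewrite exchange_big /=.
rewrite (partition_big (fun k : 'I_n => inord (p k) : 'I_n.+1) xpredT) //=.
apply: eq_bigr => u _.
have pn (k : 'I_n) : (p k < n.+1)%N by rewrite ltnS (leq_trans (p_le k)) // ltnW.
rewrite (eq_bigl (mem (block p n u))); last first.
  by move=> k; rewrite !inE -val_eqE /= inordK.
apply: eq_bigr => k /=; rewrite inE => /eqP->.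
by rewrite prodrXr -[0%N :: _]/(index_iota 0 n.+1) big_mkord.
Qed.

End PathProducts.

Section Independence.
Context (R : realType) (d : measure_display) (O : measurableType d).
Context (P : probability O R).

Lemma mutually_independent_comp (I : finType) (J : eqType) (S : Type)
    (G : set (set S)) (X : J -> O -> S) (phi : I -> J) (f : I -> S -> R) :
  injective phi -> G setT ->
  (forall i (B : set R), measurable B -> G (f i @^-1` B)) ->
  mutually_independent P G X ->
  mutually_independent P (fun B : set R => measurable B)
    (fun i w => f i (X (phi i) w)).
Proof.
move=> phi_inj GT Gf Xind s A us mA.
(* Events are indexed by all of [J]; those outside the image of [phi] are trivial. *)
pose A' j := if [pick i | phi i == j] is Some i then f i @^-1` A i else setT.
have A'E i : A' (phi i) = f i @^-1` A i.
  rewrite /A'; case: pickP => [i' /eqP/phi_inj->//|/(_ i)]; by rewrite eqxx.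
have GA' j : G (A' j) by rewrite /A'; case: pickP => // i _; exact: Gf.
have := Xind (map phi s) A'; rewrite map_inj_uniq // !big_map => /(_ us GA').
under eq_bigr do rewrite A'E.
by under [in X in _ = X -> _]eq_bigr do rewrite A'E.
Qed.

End Independence.

Section SplitVectors.
Context (R : realType) (d0 : measure_display) (O0 : measurableType d0).
Context (P0 : probability O0 R) (X : O0 -> nat -> R) (hX : split_vector P0 X).

Lemma split_vector_le1 : {ae P0, forall w, forall i, `|X w i| <= 1}.
Proof.
have [_] := hX; apply: filterS => w [X0 Xcvg] i; rewrite ger0_norm //.
have nd : nondecreasing_seq (series (X w)).
  apply/nondecreasing_seqP => k; rewrite /series /= big_nat_recr //=.
  by rewrite lerDl.
rewrite -(cvg_lim _ Xcvg) //.
apply: (@le_trans _ _ (series (X w) i.+1)).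
  by rewrite /series /= big_nat_recr //= lerDr sumr_ge0.
by apply: nondecreasing_cvgn_le => //; apply/cvg_ex; exists 1.
Qed.

(** Having a negative entry is an event of the sequence space, so it is as negligible for a copy as
    for [X]. *)
Lemma split_vector_copy_ge0 (d : measure_display) (O : measurableType d)
    (P : probability O R) (Y : O -> nat -> R) :
  random_sequence Y -> same_law (@real_sequence_events R) P Y P0 X ->
  {ae P, forall w, forall i, 0 <= Y w i}.
Proof.
move=> mY YX; pose N : set (nat -> R) := [set x | exists i, x i < 0].
have GN : real_sequence_events N.
  rewrite (_ : N = \bigcup_i [set x : nat -> R | x i < 0]); last first.
    by apply/seteqP; split => x [i] => [|_] xi; exists i.
  apply: (@bigcupT_measurable _ (g_sigma_algebraType (@coordinate_events R))) => i.
  have := @measurable_coordinate R i measurableT `]-oo, 0[%classic.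
  by rewrite setTI => /(_ (measurable_itv _)); congr (measurable _).
have [mX X0] := hX.
have mN (d' : measure_display) (O' : measurableType d') (Y' : O' -> nat -> R) :
    random_sequence Y' -> measurable (Y' @^-1` N).
  by move=> /measurable_random_sequence mY'; rewrite -[_ @^-1` _]setTI; exact: mY'.
exists (Y @^-1` N); split; [exact: mN | | ]; last first.
  move=> w /= nY; apply: contrapT => nN; apply: nY => i.
  by rewrite leNgt; apply/negP => Yi; apply: nN; exists i.
rewrite (YX _ GN); apply: (measure_negligible (mN _ _ _ mX)).
apply: negligibleS X0 => w [i Xi] [Xge0 _].
by have := Xge0 i; rewrite leNgt Xi.
Qed.

End SplitVectors.

Lemma generated_setT (T : Type) (G : set (set T)) : (<<s G >>) setT.
Proof. by have := sigma_algebraCD (@sigma_algebra0 _ setT G); rewrite setD0. Qed.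

Section BlockLabellings.
Variables (p : nat -> nat) (n N : nat).
Hypothesis p_le : forall k, (p k <= k)%N.

(** Blocks partition the edges, so distinctness among siblings is a separate condition on each
    block. Labellings thus form a product, which lets a product of occupancies expand into a sum
    over [G]. *)
Definition block_labelling (G : {ffun 'I_n.+1 -> {ffun 'I_n -> option 'I_N}}) : bool :=
  G \in family (fun u : 'I_n.+1 => @labelling 'I_n N (block p n u)).

Definition label_function (G : {ffun 'I_n.+1 -> {ffun 'I_n -> option 'I_N}})
    (k : nat) : nat :=
  oapp (fun i : 'I_n => label_of (G (inord (p i)) i)) 0%N (insub k).

Lemma label_function_block G (u : 'I_n.+1) (k : 'I_n) : k \in block p n u ->
  label_function G k = label_of (G u k).
Proof. by rewrite inE /label_function valK /= => /eqP->; rewrite inord_val. Qed.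

Let own_block (k : 'I_n) : k \in block p n (inord (p k) : 'I_n.+1).
Proof. by rewrite inE inordK // ltnS (leq_trans (p_le k)) // ltnW. Qed.

Let label_some G (u : 'I_n.+1) (k : 'I_n) : block_labelling G -> k \in block p n u ->
  exists2 a, G u k = Some a & label_function G k = val a.
Proof.
move=> /familyP/(_ u)/labellingP[GA _] ku; rewrite (label_function_block _ ku).
by have := GA k; rewrite ku; case: (G u k) => // a _; exists a.
Qed.

Lemma label_function_sibling G : block_labelling G ->
  sibling_injective p n (label_function G).
Proof.
move=> vG i k i_n kn pik lik; pose i' := Ordinal i_n; pose k' := Ordinal kn.
have i'u : i' \in block p n (inord (p k) : 'I_n.+1).
  by have := own_block k'; rewrite !inE /= pik.
have [a Ga la] := label_some vG i'u; have [b Gb lb] := label_some vG (own_block k').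
have ab : a = b by apply/val_inj; rewrite /= -la -lb.
have /familyP/(_ (inord (p k)))/labellingP[_ ginj] := vG.
by rewrite ab in Ga; have /(congr1 val) := ginj _ _ _ Ga Gb.
Qed.

Lemma label_function_inj G G' : block_labelling G -> block_labelling G' ->
  (forall k, (k < n)%N -> label_function G k = label_function G' k) -> G = G'.
Proof.
move=> vG vG' GG'; apply/ffunP => u; apply/ffunP => k.
have [ku|ku] := boolP (k \in block p n u).
  have [a Ga la] := label_some vG ku; have [b Gb lb] := label_some vG' ku.
  by rewrite Ga Gb; congr Some; apply/val_inj; rewrite /= -la -lb GG'.
have none H : block_labelling H -> H u k = None.
  by move=> /familyP/(_ u)/labellingP[HA _]; have := HA k; rewrite (negbTE ku); case: (H u k).
by rewrite !none.
Qed.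

End BlockLabellings.

Section SplitTrees.
Context (R : realType).
Context (d0 : measure_display) (O0 : measurableType d0) (P0 : probability O0 R).
Context (X : O0 -> nat -> R) (hX : split_vector P0 X).
Context (d : measure_display) (O : measurableType d) (P : probability O R).
Context (Q : node -> O -> nat -> R) (C : nat -> node -> O -> nat).
Hypothesis mQ : forall v, random_sequence (Q v).
Hypothesis QX : forall v, same_law (@real_sequence_events R) P (Q v) P0 X.
Hypothesis Qind : mutually_independent P (@real_sequence_events R) Q.
Hypothesis mC : forall k v, measurable_fun [set: O] (C k v).
Hypothesis CQ : forall (s : seq (nat * node)) (i : nat * node -> nat) (A : set O),
  uniq s -> vector_events Q A ->
  P (A `&` \big[setI/setT]_(x <- s) [set w | C x.1 x.2 w = i x]) =
  (\int[P]_(w in A) (\prod_(x <- s) Q x.2 w (i x))%:E)%E.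

Let choices (w : O) (k : nat) (v : node) : nat := C k v w.

Lemma measurable_fibers_choice k v : measurable_fibers (C k v).
Proof. by move=> c; have := mC k v measurableT (Y := [set c]) Logic.I; rewrite setTI. Qed.

Lemma measurable_fibers_landing_node t k :
  measurable_fibers (fun w => landing_node t (choices w k)).
Proof.
rewrite /landing_node; elim: #|` t| => [|m IH]; first exact: measurable_fibers_cst.
pose step v w : node := if v \in t then rcons v (choices w k v) else v.
apply: (measurable_fibers_bind (g := step) IH) => v; rewrite /step.
case: (v \in t); last exact: measurable_fibers_cst.
exact: (measurable_fibers_comp (rcons v) (measurable_fibers_choice k v)).
Qed.

Lemma measurable_fibers_split_tree m : measurable_fibers (fun w => split_tree (choices w) m).
Proof.
elim: m => [|m IH]; first exact: measurable_fibers_cst.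
pose step t w : tree := (t `|` [fset landing_node t (choices w m)])%fset.
apply: (measurable_fibers_bind (g := step) IH) => t.
exact: (measurable_fibers_comp (fun v => (t `|` [fset v])%fset)
  (measurable_fibers_landing_node t m)).
Qed.

Variables (p : nat -> nat) (n : nat).
Hypothesis p_le : forall k, (p k <= k)%N.

Lemma follows_bigcap l : [set w | follows p l n (choices w)] =
  \big[setI/setT]_(x <- path_steps p l n)
    [set w | C x.1 x.2 w = nth 0%N (addr p l x.1) (size x.2)].
Proof.
rewrite -bigcap_seq; apply/seteqP; split => w /=.
  move=> fw x /= /allpairsPdep[j [i [jn ia ->]]] /=.
  rewrite !mem_iota !add0n ltnS /= in jn ia.
  by rewrite size_takel ?(ltnW ia) // -fw.
move=> fw j jn i ia.
have := fw (j, take i (addr p l j)); rewrite /= size_takel ?(ltnW ia) //; apply.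
by apply/allpairsPdep; exists j, i; rewrite !mem_iota !add0n ltnS.
Qed.

Lemma measurable_follows l : measurable [set w | follows p l n (choices w)].
Proof.
rewrite follows_bigcap; apply: bigsetI_measurable => x _.
exact: measurable_fibers_choice.
Qed.

Let monomial l (u : 'I_n.+1) (x : nat -> R) : R :=
  \prod_(k in block p n u) `|x (l (val k))| ^+ passages p k.

Let measurable_monomial_l l u : measurable_fun
  [set: g_sigma_algebraType (@coordinate_events R)] (monomial l u).
Proof. exact: (@measurable_monomial R _ (@passages p n) (fun k => l (val k)) (block p n u)). Qed.

Let monomial_ge0 l u x : 0 <= monomial l u x.
Proof. by apply: prodr_ge0 => k _; rewrite exprn_ge0. Qed.

Lemma monomial_fin l u : (\int[P0]_w (monomial l u (X w))%:E < +oo)%E.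
Proof.
apply: (@le_lt_trans _ _ (\int[P0]_w (cst 1%:E w))%E).
  apply: ae_ge0_le_integral => //.
  + by move=> w _; rewrite lee_fin.
  + apply/measurable_EFinP.
    exact: measurableT_comp (measurable_monomial_l l u)
      (measurable_random_sequence (proj1 hX)).
  apply: filterS (split_vector_le1 hX) => w X1 _; rewrite lee_fin.
  by apply: prodr_ile1 => k _; rewrite exprn_ge0 //= exprn_ile1.
rewrite integral_cst; last exact: measurableT.
by rewrite mul1e (le_lt_trans (probability_le1 _ _)) ?ltry.
Qed.

(** Integrating the conditional probability gives the mean of a product of monomials, one for each
    node. The nodes are distinct, so their vectors are independent copies of [X] and the mean
    factorises. *)
Lemma prob_follows l : sibling_injective p n l ->
  P [set w | follows p l n (choices w)] =
  (\prod_(u < n.+1) \int[P0]_w (monomial l u (X w))%:E)%E.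
Proof.
move=> linj; rewrite follows_bigcap -[X in P X]setTI CQ; last 2 first.
- exact: uniq_path_steps.
- exact: generated_setT.
have mQl u : measurable_fun [set: O] (fun w => monomial l u (Q (addr p l u) w)).
  exact: measurableT_comp (measurable_monomial_l l u)
    (measurable_random_sequence (mQ (addr p l u))).
have EQ u : (\int[P]_w (monomial l u (Q (addr p l u) w))%:E =
    \int[P0]_w (monomial l u (X w))%:E)%E.
  exact: (same_law_integral (mQ _) (proj1 hX) (@QX _) (measurable_monomial_l l u)
    (monomial_ge0 l u)).
transitivity (\int[P]_w (\prod_(u < n.+1) monomial l u (Q (addr p l u) w))%:E)%E.
  apply: ae_eq_integral => //.
  - apply/measurable_EFinP; apply: measurable_prod => x _; exact: mQ.
  - by apply/measurable_EFinP; apply: measurable_prod => u _.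
  (* Almost sure nonnegativity of the copies allows absolute values to be inserted. *)
  have : {ae P, forall w, forall u : 'I_n.+1, forall i, 0 <= Q (addr p l u) w i}.
    apply: filter_forall => u.
    exact: (split_vector_copy_ge0 hX (mQ _) (@QX _)).
  apply: filterS => w Q0 _; congr _%:E.
  rewrite (prod_path_steps _ _ p_le (fun v => Q v w)).
  apply: eq_bigr => u _; apply: eq_bigr => k _; by rewrite ger0_norm.
rewrite integral_prod_independent.
- by apply: eq_bigr => u _; exact: EQ.
- exact: mQl.
- by [].
- by move=> u; rewrite EQ; exact: monomial_fin.
- apply: (@mutually_independent_comp R d O P 'I_n.+1 node (nat -> R)
    (@real_sequence_events R) Q (fun u => addr p l u) (monomial l)) Qind.
  + move=> u v /(addr_inj p_le linj) e; by apply/val_inj/e; rewrite /= -ltnS ltn_ord.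
  + exact: generated_setT.
  + by move=> u B mB; exact: real_sequence_events_preimage.
- exact: index_enum_uniq.
Qed.

Let unordered_event : set O := [set w | forall i, (i <= n)%N ->
  unordered (fun j => split_tree (choices w) j.+1) i =
  history_tree p (sibling_rank p) i].

Let follows_unordered l : sibling_injective p n l ->
  [set w | follows p l n (choices w)] `<=` unordered_event.
Proof.
move=> linj w fw; apply: (unordered_history p_le linj).
exact: split_tree_follows.
Qed.

Lemma follows_determines l l' w : sibling_injective p n l -> sibling_injective p n l' ->
  follows p l n (choices w) -> follows p l' n (choices w) ->
  forall k, (k < n)%N -> l k = l' k.
Proof.
move=> linj linj' fl fl' k kn.
suff aE j : (j <= n)%N -> addr p l j = addr p l' j.
  by have [] := addr_determines p_le p_le linj aE kn.
apply: (history_tree_addr p_le p_le linj linj') => i i_n.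
by rewrite -(split_tree_follows p_le linj fl i_n) -(split_tree_follows p_le linj' fl' i_n).
Qed.

Let block_occupancy N (u : nat) : \bar R :=
  (\int[P0]_w (occupancy (@passages p n) N (fun i => `|X w i|) (block p n u))%:E)%E.

(** Each labelling with labels below [N] gives an event inside [unordered_event], and these events
    are disjoint because the tree sequence determines the labels. *)
Lemma unordered_prob_ge_occupancy N : measurable unordered_event ->
  ((\prod_(u < n.+1) fine (block_occupancy N u))%:E <= P unordered_event)%E.
Proof.
move=> mU; pose E G := [set w | follows p (@label_function p n N G) n (choices w)].
pose h (u : 'I_n.+1) (g : {ffun 'I_n -> option 'I_N}) : \bar R :=
  (\int[P0]_w (\prod_(k in block p n u) `|X w (label_of (g k))| ^+ passages p k)%:E)%E.
have h_label (G : {ffun 'I_n.+1 -> {ffun 'I_n -> option 'I_N}}) u :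
    (\int[P0]_w (monomial (label_function p G) u (X w))%:E = h u (G u))%E.
  apply: eq_integral => w _; congr _%:E; apply: eq_bigr => k ku.
  by rewrite (label_function_block _ ku).
have h_fin u g : h u g \is a fin_num.
  rewrite ge0_fin_numE; last first.
    by apply: integral_ge0 => w _; rewrite lee_fin; apply: prodr_ge0 => k _; rewrite exprn_ge0.
  have := @h_label [ffun=> g] u; rewrite ffunE => <-; exact: monomial_fin.
have occ (u : 'I_n.+1) : block_occupancy N u = (\sum_(g | @labelling 'I_n N (block p n u) g) h u g)%E.
  rewrite /block_occupancy /occupancy; under eq_integral do rewrite -sumEFin -big_filter.
  rewrite ge0_integral_sum ?big_filter //.
  - move=> g; apply/measurable_EFinP.
    exact: measurableT_comp
      (@measurable_monomial R _ (@passages p n) (fun k => label_of (g k)) (block p n u))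
      (measurable_random_sequence (proj1 hX)).
  - by move=> g w _; rewrite lee_fin; apply: prodr_ge0 => k _; rewrite exprn_ge0.
apply: (@le_trans _ _ (P (\bigcup_(G in [set` @block_labelling p n N]) E G))); last first.
  apply: le_measure; rewrite ?inE //.
    by apply: fin_bigcup_measurable => // G _; exact: measurable_follows.
  move=> w [G vG]; apply: follows_unordered; exact: label_function_sibling.
rewrite measure_finType_bigcup; last 2 first.
- by move=> G _; exact: measurable_follows.
- move=> G G' /= vG vG' [w [wG wG']].
  apply: (label_function_inj vG vG').
  by apply: follows_determines wG wG'; exact: label_function_sibling.
rewrite (eq_bigr (fun u : 'I_n.+1 => \sum_(g | @labelling 'I_n N (block p n u) g) fine (h u g))); last first.
  by move=> u _; rewrite occ -sum_fine.
(* Distributivity turns the product over nodes of sums over labellings of a block into a sum over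
   the joint labellings. *)
rewrite bigA_distr_big_dep -sumEFin le_eqVlt; apply/orP; left; apply/eqP.
apply: eq_big => [G//|G vG]; rewrite prob_follows; last exact: label_function_sibling.
rewrite -prodEFin; apply: eq_bigr => u _.
by rewrite fineK // h_label.
Qed.

Lemma unordered_prob_ge : measurable unordered_event ->
  (forall u : 'I_n.+1,
    block_occupancy N u @[N --> \oo] --> (ewens R (@passages p n) (block p n u))%:E) ->
  ((n`!%:R^-1)%:E <= P unordered_event)%E.
Proof.
move=> mU occ; rewrite -(prod_ewens_block R n p_le).
have /fineK <- := fin_num_measure P _ mU; rewrite lee_fin.
have cvgp : \prod_(u < n.+1) fine (block_occupancy N u) @[N --> \oo] -->
    \prod_(u < n.+1) ewens R (@passages p n) (block p n u).
  apply: cvg_big => [|u _]; first exact: mul_continuous.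
  by apply: fine_cvg; exact: occ.
rewrite -(cvg_lim _ cvgp) //; apply: limr_le; first by apply/cvg_ex; eexists; exact: cvgp.
apply: nearW => N; rewrite -lee_fin fineK ?fin_num_measure //.
exact: unordered_prob_ge_occupancy.
Qed.

End SplitTrees.

(** * The limit for GEM and PD vectors *)

Section OccupancyLimits.
Variables (R : realType) (I : finType) (m : I -> nat) (A : {set I}).
Hypothesis m_gt0 : forall k, (0 < m k)%N.

Let occ (x : nat -> R) (N : nat) : R := occupancy m N (fun i => `|x i|) A.

Lemma GEM_occupancy_cvg (d : measure_display) (O : measurableType d)
    (P : probability O R) (X : O -> nat -> R) : GEM_distributed 0 1 P X ->
  (\int[P]_w (occ (X w) N)%:E @[N --> \oo] --> (ewens R m A)%:E)%E.
Proof.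
move=> gX; under eq_fun do rewrite (GEM_occupancy m _ A gX).
by apply: cvg_EFin; [exact: nearW|exact: mean_occupancy_cvg].
Qed.

(** This is the sum over all injective labellings by natural numbers. Unlike its truncations
    [occ x N], it is invariant under permutations of [x]. *)
Let total_occ (x : nat -> R) : \bar R := ereal_sup (range (fun N => (occ x N)%:E)).

Lemma occ_nd x : nondecreasing_seq (fun N => (occ x N)%:E).
Proof.
apply/nondecreasing_seqP => N; rewrite lee_fin.
apply: (@le_occupancy _ _ _ N N.+1 (widen_ord (leqnSn N))) => // i j.
by move=> /(congr1 val) e; exact: val_inj.
Qed.

Lemma total_occ_cvg x : (occ x N)%:E @[N --> \oo] --> total_occ x.
Proof. by apply: ereal_nondecreasing_cvgn; exact: occ_nd. Qed.

Lemma total_occ_le (x y : nat -> R) (s : nat -> nat) : injective s ->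
  (forall i, x i = y (s i)) -> (total_occ x <= total_occ y)%E.
Proof.
move=> s_inj xy; apply: ge_ereal_sup => _ [N _ <-].
(* [M] exceeds the images under [s] of all labels below [N]. *)
pose M := (\max_(i < N) s i).+1.
have sM (i : 'I_N) : (s i < M)%N by rewrite ltnS (leq_bigmax i).
apply: (@le_trans _ _ (occ y M)%:E); last by apply: ereal_sup_ubound; exists M.
rewrite lee_fin; apply: (@le_occupancy _ _ _ N M (fun i => Ordinal (sM i))).
- by move=> i j /(congr1 val) /s_inj e; exact: val_inj.
- by move=> i; rewrite /= xy.
- by move=> i; exact: normr_ge0.
Qed.

Lemma decreasing_reordering_total_occ (x y : nat -> R) :
  decreasing_reordering x y -> total_occ x = total_occ y.
Proof.
move=> [_ [s [s' sK s'K] yx]]; apply/eqP; rewrite eq_le; apply/andP; split.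
  apply: (@total_occ_le _ _ s'); first exact: can_inj s'K.
  by move=> i; rewrite yx s'K.
by apply: (@total_occ_le _ _ s) => //; exact: can_inj sK.
Qed.

Section TotalOccupancy.
Context (d : measure_display) (O : measurableType d) (P : probability O R).
Context (Y : O -> nat -> R) (mY : random_sequence Y).

Lemma measurable_occ N : measurable_fun [set: O] (fun w => (occ (Y w) N)%:E).
Proof.
apply/measurable_EFinP.
exact: measurableT_comp (measurable_occupancy m N A) (measurable_random_sequence mY).
Qed.

Lemma measurable_total_occ : measurable_fun [set: O] (fun w => total_occ (Y w)).
Proof.
apply: (emeasurable_fun_cvg (fun N w => (occ (Y w) N)%:E)).
  exact: measurable_occ.
by move=> w _; exact: total_occ_cvg.
Qed.

Lemma occ_ge0 x N : 0 <= occ x N.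
Proof. by apply: occupancy_ge0 => i; exact: normr_ge0. Qed.

Lemma total_occ_ge0 x : (0 <= total_occ x)%E.
Proof.
apply: (@le_trans _ _ (occ x 0)%:E); first by rewrite lee_fin occ_ge0.
by apply: ereal_sup_ubound; exists 0%N.
Qed.

Lemma integral_total_occ_cvg :
  (\int[P]_w (occ (Y w) N)%:E @[N --> \oo] --> \int[P]_w total_occ (Y w))%E.
Proof.
rewrite (_ : (\int[P]_w total_occ (Y w) =
    \int[P]_w limn (fun N => (occ (Y w) N)%:E))%E); last first.
  by apply: eq_integral => w _; apply/esym/cvg_lim => //; exact: total_occ_cvg.
apply: cvg_monotone_convergence => //.
- exact: measurable_occ.
- by move=> N w _; rewrite lee_fin occ_ge0.
- by move=> w _; exact: occ_nd.
Qed.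

End TotalOccupancy.

(** The total occupancies of the GEM vector and of its reordering agree almost surely, and both
    means are limits of truncated ones by monotone convergence. *)
Lemma PD_occupancy_cvg (d : measure_display) (O : measurableType d)
    (P : probability O R) (X : O -> nat -> R) : PD_distributed 0 1 P X ->
  (\int[P]_w (occ (X w) N)%:E @[N --> \oo] --> (ewens R m A)%:E)%E.
Proof.
move=> [mX [d' [Om [P' [Y [Y' [gY mY' reord XY']]]]]]].
have mY := proj1 gY.
have XE N : (\int[P]_w (occ (X w) N)%:E = \int[P']_w (occ (Y' w) N)%:E)%E.
  exact: (same_law_integral mX mY' XY' (measurable_occupancy m N A) (occ_ge0 ^~ N)).
under eq_fun do rewrite XE.
suff -> : (ewens R m A)%:E = (\int[P']_w total_occ (Y' w))%E.
  exact: integral_total_occ_cvg.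
rewrite -(cvg_lim _ (GEM_occupancy_cvg gY)) //.
rewrite (cvg_lim _ (integral_total_occ_cvg mY)) //.
apply: ge0_ae_eq_integral => //.
- exact: measurable_total_occ.
- exact: measurable_total_occ.
- by move=> w _; exact: total_occ_ge0.
- by move=> w _; exact: total_occ_ge0.
by apply: filterS reord => w YY' _; exact: decreasing_reordering_total_occ.
Qed.

End OccupancyLimits.

(** * Laws of sequences of unordered trees *)

Section UnorderedLaws.

Lemma unordered_ext (t t' : nat -> tree) n :
  (forall k, (k <= n)%N -> t k = t' k) -> unordered t n = unordered t' n.
Proof.
move=> tt'; rewrite /unordered /relabel_node /appearance_rank tt' //.
apply: eq_imfset => // v; apply: eq_mkseq => j.
congr (#|` _ |); apply/fsetP => u; rewrite !in_fset !inE; congr (_ && _).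
by apply: eq_existsb => k; rewrite tt' // ltnW.
Qed.

(** Only the trees up to time [i] matter, so the value is a function of a finite list of trees,
    which ranges over a countable type. *)
Lemma measurable_fibers_unordered (d : measure_display) (O : measurableType d)
    (t : nat -> O -> tree) i : (forall k, measurable_fibers (t k)) ->
  measurable_fibers (fun w => unordered (t ^~ w) i).
Proof.
move=> mt.
rewrite (_ : (fun w => _) =
    (fun w => unordered (nth fset0 (mkseq (t ^~ w) i.+1)) i)).
  apply: (measurable_fibers_comp (fun s => unordered (nth fset0 s) i)).
  exact: measurable_fibers_mkseq.
by apply/funext => w; apply: unordered_ext => k ki; rewrite nth_mkseq.
Qed.

Lemma history_tree_parent_inj n (q q' : history n) :
  (forall i, (i <= n)%N ->
    history_tree (parent q) (sibling_rank (parent q)) i =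
    history_tree (parent q') (sibling_rank (parent q')) i) -> q = q'.
Proof.
move=> qq'; apply: parent_inj => k kn.
have qi := sibling_rank_injective (p := parent q) (n := n).
have qi' := sibling_rank_injective (p := parent q') (n := n).
have := history_tree_addr (parent_le q) (parent_le q') qi qi' qq'.
by move=> /(addr_determines (parent_le q) (parent_le q') qi)/(_ k kn)[].
Qed.

(* As there are exactly n! histories, lower bounds on their probabilities force
   equality. *)
Lemma same_law_unordered (R : realType) (d1 d2 : measure_display)
    (O1 : measurableType d1) (O2 : measurableType d2)
    (P1 : probability O1 R) (P2 : probability O2 R)
    (t1 : nat -> O1 -> tree) (t2 : nat -> O2 -> tree) :
  (forall k, measurable_fibers (t1 k)) -> (forall k, measurable_fibers (t2 k)) ->
  (forall n p, (forall k, (p k <= k)%N) ->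
    ((n`!%:R^-1)%:E <= P1 [set w | forall i, (i <= n)%N ->
      unordered (t1 ^~ w) i = history_tree p (sibling_rank p) i])%E) ->
  (forall n p, (forall k, (p k <= k)%N) ->
    ((n`!%:R^-1)%:E <= P2 [set w | forall i, (i <= n)%N ->
      unordered (t2 ^~ w) i = history_tree p (sibling_rank p) i])%E) ->
  same_law tree_sequence_events P1 (fun w => unordered (t1 ^~ w))
    P2 (fun w => unordered (t2 ^~ w)).
Proof.
move=> mt1 mt2 b1 b2.
have mU1 i := measurable_fibers_unordered i mt1.
have mU2 i := measurable_fibers_unordered i mt2.
apply: product_sigma_same_law => // n A dA.
pose B (q : history n) := history_tree (parent q) (sibling_rank (parent q)).
have card_gt0 : (0 < #|{: history n}|)%N by rewrite card_history fact_gt0.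
rewrite (@determined_prob _ _ _ _ P1 _ mU1 n _ B) //; last 2 first.
- exact: history_tree_parent_inj.
- by move=> q; rewrite card_history b1 //; exact: parent_le.
rewrite (@determined_prob _ _ _ _ P2 _ mU2 n _ B) //.
- exact: history_tree_parent_inj.
- by move=> q; rewrite card_history b2 //; exact: parent_le.
Qed.

End UnorderedLaws.

(** The law of the split vector enters only through the limits of its mean occupancies, so GEM and
    PD are treated alike. *)
Lemma recursive_split_same_law (R : realType)
    (d1 : measure_display) (O1 : measurableType d1) (P1 : probability O1 R)
    (T : nat -> O1 -> tree) (hT : random_recursive_trees P1 T)
    (d0 : measure_display) (O0 : measurableType d0) (P0 : probability O0 R)
    (X : O0 -> nat -> R)
    (d2 : measure_display) (O2 : measurableType d2) (P2 : probability O2 R)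
    (S : nat -> O2 -> tree) (hS : random_split_trees P0 X P2 S) :
  (forall (I : finType) (m : I -> nat) (A : {set I}), (forall k, (0 < m k)%N) ->
    (\int[P0]_w (occupancy m N (fun i => `|X w i|) A)%:E @[N --> \oo] -->
     (ewens R m A)%:E)%E) ->
  same_law tree_sequence_events P1 (fun w => unordered (fun n => T n.+1 w))
    P2 (fun w => unordered (fun n => S n.+1 w)).
Proof.
move=> occX; have [hX [Q [C [[mQ [QX Qind]] mC SC CQ]]]] := hS.
have mS k : measurable_fibers (S k).
  rewrite (_ : S k = fun w => split_tree (fun k v => C k v w) k).
    exact: measurable_fibers_split_tree.
  by apply/funext => w; rewrite SC.
have mT := measurable_fibers_random_recursive_trees hT.
apply: (same_law_unordered (t1 := fun n => T n.+1) (t2 := fun n => S n.+1)) => //.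
- move=> n p p_le; apply: le_trans (random_recursive_trees_prob_ge hT n p_le) _.
  have mev (U : nat -> O1 -> tree) (B : nat -> tree) : (forall k, measurable_fibers (U k)) ->
      measurable [set w | forall i, (i <= n)%N -> U i w = B i].
    move=> mU; apply: (@measurable_determined _ _ _ (fun w i => U i w) mU n
      [set x | forall i, (i <= n)%N -> x i = B i]) => x y xy xB i i_n.
    by rewrite -xy // xB.
  apply: le_measure; rewrite ?inE.
  + exact: (mev (fun i => T i.+1)).
  + apply: (mev (fun i w => unordered (fun n => T n.+1 w) i)) => i.
    exact: (measurable_fibers_unordered (t := fun n => T n.+1)).
  (* The recursive tree is labelled by sibling ranks already, so relabelling leaves it unchanged. *)
  + move=> w Tw; apply: (unordered_history p_le _ Tw).
    exact: sibling_rank_injective.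
- move=> n p p_le.
  have SE w : (fun k => S k.+1 w) = (fun k => split_tree (fun k v => C k v w) k.+1).
    by apply/funext => k; rewrite SC.
  rewrite (_ : [set w | _] = [set w | forall i, (i <= n)%N ->
      unordered (fun j => split_tree (fun k v => C k v w) j.+1) i =
      history_tree p (sibling_rank p) i]); last first.
    by apply/seteqP; split => w /=; rewrite SE.
  apply: (unordered_prob_ge hX mQ QX Qind mC CQ p_le).
    rewrite (_ : [set w | _] = (fun w i => unordered (fun n => S n.+1 w) i) @^-1`
        [set x | forall i, (i <= n)%N -> x i = history_tree p (sibling_rank p) i]).
      apply: (@measurable_determined _ _ _ _ _ n) => [i|x y xy xB i i_n].
        exact: (measurable_fibers_unordered (t := fun n => S n.+1)).
      by rewrite -xy // xB.
    by apply/seteqP; split => w /=; rewrite SE.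
  by move=> u; apply: occX => k; exact: passages_gt0.
Qed.

Theorem corollary1p6 (R : realType)
    (d1 : measure_display) (O1 : measurableType d1) (P1 : probability O1 R)
    (T : nat -> O1 -> tree) (hT : random_recursive_trees P1 T)
    (d0 : measure_display) (O0 : measurableType d0) (P0 : probability O0 R)
    (X : O0 -> nat -> R)
    (d2 : measure_display) (O2 : measurableType d2) (P2 : probability O2 R)
    (S : nat -> O2 -> tree) (hS : random_split_trees P0 X P2 S) :
  (GEM_distributed 0 1 P0 X ->
     same_law tree_sequence_events
       P1 (fun w => unordered (fun n => T n.+1 w))
       P2 (fun w => unordered (fun n => S n.+1 w))) /\
  (PD_distributed 0 1 P0 X ->
     same_law tree_sequence_events
       P1 (fun w => unordered (fun n => T n.+1 w))
       P2 (fun w => unordered (fun n => S n.+1 w))).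
Proof.
split=> hX; apply: (recursive_split_same_law hT hS) => I m A m_gt0.
  exact: GEM_occupancy_cvg.
exact: PD_occupancy_cvg.
Qed.
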